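(* Let $(\boldsymbol{\nu},f)$ be an $r$-colored tuple of vertical strips, let $G=G_{\boldsymbol{\nu}}$ be the associated LLT graph, and let $E_d=E_d(G)$. Then $$\kappa_{\mathrm{LLT}}(\boldsymbol{\nu},f)(q+1)=\sum_{\substack{E\subseteq E_d\\ G^E\ f\text{-connected}}}q^{|E|+1-r}\,e_{\lambda(G^E)},$$ where $(q+1)$ means that $q$ is replaced by $q+1$ and $e_\lambda$ denotes the elementary symmetric function.
   Context: A tuple of vertical strips is $\boldsymbol{\nu}=(\nu_1,\dots,\nu_\ell)$ with $\nu_i=(1^{n_i+k_i})/(1^{k_i})$, $n_i,k_i$ nonnegative integers. Diagrams are in the French convention: $\nu_i$ is the set of boxes $(x,y)$ with $x=1$ (column) and $k_i<y\le n_i+k_i$ (row, numbered from bottom to top). A box $\square=(x,y)\in\nu_i$ has content $c(\square)=x-y$ and shifted content $\tilde c(\square)=\ell c(\square)+i-1$. The box $\square$ attacks $\square'$ if $0<\tilde c(\square')-\tilde c(\square)<\ell$. For a tuple of skew diagrams $\boldsymbol{\nu}$, $\mathrm{SSYT}(\boldsymbol{\nu})$ is the set of fillings $T$ of the boxes by positive integers that in each $\nu_i$ weakly increase along rows (left to right) and strictly increase in columns (bottom to top); $\operatorname{inv}(T)$ is the number of pairs $(\square,\square')$ such that $\square$ attacks $\square'$ and $T(\square)>T(\square')$; $\mathrm{LLT}(\boldsymbol{\nu})=\sum_{T\in\mathrm{SSYT}(\boldsymbol{\nu})}q^{\operatorname{inv}(T)}\prod_\square x_{T(\square)}$. An $r$-colored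 tuple $(\boldsymbol{\nu},f)$ is an $\ell$-tuple $\boldsymbol{\nu}$ with a surjection $f:[1..\ell]\to[1..r]$. For $B\subseteq[1..r]$ with $f^{-1}(B)=\{i_1<\dots<i_k\}$, $(\boldsymbol{\nu},f)^B:=(\nu_{i_1},\dots,\nu_{i_k})$ (shifted contents recomputed in the $k$-tuple). The LLT cumulant is $$\kappa_{\mathrm{LLT}}(\boldsymbol{\nu},f)=(q-1)^{1-r}\sum_{\pi\in\mathcal{P}([1..r])}(-1)^{|\pi|-1}(|\pi|-1)!\prod_{B\in\pi}\mathrm{LLT}((\boldsymbol{\nu},f)^B),$$ where $\mathcal{P}([1..r])$ is the set of set-partitions of $[1..r]=\{1,\dots,r\}$. The LLT graph $G_{\boldsymbol{\nu}}$ of a tuple of vertical strips is the directed graph whose vertices are the boxes of $\boldsymbol{\nu}$, with a type I edge from each box $\square$ to the box directly below it (when that box is in $\boldsymbol{\nu}$), and a double edge from $\square$ to $\square'$ whenever $\square$ attacks $\square'$; $E_1(G)$ and $E_d(G)$ are the sets of type I and double edges. Vertices are labelled by their shifted contents (which are distinct). A box of $\nu_i$ has color $f(i)$. For $E\subseteq E_d(G)$, $G^E$ is the directed graph with the same vertices and edge set $E_1(G)\cup E$ (the other double edges are deleted). $G^E$ is $f$-connected if the graph obtained from it by identifying all vertices of the same color is connected (ignoring directions). For $G'=G^E$: a source is a vertex without incoming edges. For a vertex $v$ let $\theta(v)$ be the source with the smallest label from which there is a directed path (possibly of length $0$) to $v$. Put $v\sim w$ if $\theta(v)=\theta(w)$.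 Then $\lambda(G')$ is the partition whose parts are the sizes of the equivalence classes of $\sim$. Finally $e_\lambda=\prod_i e_{\lambda_i}$ with $e_i=\sum_{j_1<\dots<j_i}x_{j_1}\cdots x_{j_i}$.
   Formalization: In f-connectedness the identified graph has all r colors as vertices, so a color with only empty strips is isolated; read literally, the formula fails for ℓ=r=2, ν=(empty strip, one box): left side 0, right side e_1/q. Also r≥1 is assumed. *)

(* Defs.v *)
From HB Require Import structures.
From mathcomp Require Import all_boot all_order all_algebra.
From mathcomp Require Import fraction mpoly.

Set Implicit Arguments.
Unset Strict Implicit.
Unset Printing Implicit Defensive.

Import Order.TTheory GRing.Theory Num.Theory.
Local Open Scope ring_scope.

(* The skew shape (1^(n + k)) / (1^k), with n = strip_len and k = strip_base. *)
Record vstrip := VStrip { strip_len : nat; strip_base : nat }.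

Section Boxes.

Variables (l : nat) (nu : 'I_l -> vstrip).

(* Tagged i j is the j-th box of nu_i from the bottom, both counted from 0. *)
Definition box : finType := {i : 'I_l & 'I_(strip_len (nu i))}.

Implicit Types b c : box.

Definition box_col b : nat := 1.
Definition box_row b : nat := (strip_base (nu (tag b)) + (tagged b).+1)%N.

Definition content b : int := (box_col b)%:Z - (box_row b)%:Z.

(* The strips are indexed from 0, so the usual "+ i - 1" becomes "+ i". *)
Definition shifted_content b : int := l%:Z * content b + (tag b : nat)%:Z.

Definition attacks b c : bool :=
  0 < shifted_content c - shifted_content b < l%:Z.

End Boxes.

Section LLT.

(* Symmetric functions are handled through their images in N variables x_0,
   ..., x_(N-1), N being arbitrary; entries of fillings are counted from 0. *)
Variables (N : nat) (K : fieldType) (q : K).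

Definition filling l (nu : 'I_l -> vstrip) := {ffun box nu -> 'I_N}.

Definition semistandard l (nu : 'I_l -> vstrip) (T : filling nu) : bool :=
  [forall b, forall c, (tag b == tag c) ==>
     ((box_row b == box_row c) && (box_col b < box_col c)%N ==> (T b <= T c)%N)
  && ((box_col b == box_col c) && (box_row b < box_row c)%N ==> (T b < T c)%N)].

Definition inv l (nu : 'I_l -> vstrip) (T : filling nu) : nat :=
  #|[set p : box nu * box nu | attacks p.1 p.2 & (T p.2 < T p.1)%N]|.

Definition LLT l (nu : 'I_l -> vstrip) : {mpoly K[N]} :=
  \sum_(T : filling nu | semistandard T) q ^+ inv T *: \prod_(b : box nu) 'X_(T b).

(* (nu, f)^B: enum_val lists the elements of f^-1(B) in increasing order. *)
Definition restrict l r (nu : 'I_l -> vstrip) (f : 'I_l -> 'I_r)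
    (B : {set 'I_r}) : 'I_#|f @^-1: B| -> vstrip :=
  fun j => nu (enum_val j).
Arguments restrict [l r] nu f B j.

Definition LLT_cumulant l r (nu : 'I_l -> vstrip) (f : 'I_l -> 'I_r) :
    {mpoly K[N]} :=
  (q - 1) ^ (1 - r%:Z) *:
  \sum_(P : {set {set 'I_r}} | partition P [set: 'I_r])
     ((-1) ^+ #|P|.-1 * (#|P|.-1)`!%:R : K) *:
     \prod_(B in P) LLT (restrict nu f B).

End LLT.

Section LLTGraph.

Variables (l : nat) (nu : 'I_l -> vstrip).

Definition typeI_edge : rel (box nu) :=
  fun b c => (tag b == tag c) && (box_row b == (box_row c).+1).

Definition double_edges : {set box nu * box nu} := [set p | attacks p.1 p.2].

Variable E : {set box nu * box nu}.

(* The edge relation of G^E. *)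
Definition edge : rel (box nu) := fun b c => typeI_edge b c || ((b, c) \in E).

(* The graph G^E with vertices of equal colour identified has one vertex for
   each colour, including the colours all of whose strips are empty. *)
Definition contracted_edge r (f : 'I_l -> 'I_r) : rel 'I_r := fun i j =>
  [exists b, exists c,
     [&& f (tag b) == i, f (tag c) == j & edge b c || edge c b]].

Definition f_connected r (f : 'I_l -> 'I_r) : bool :=
  [forall i, forall j, connect (contracted_edge f) i j].

Definition source (b : box nu) : bool := [forall c, ~~ edge c b].

(* This is never None when E consists of double edges: all edges increase
   the label, so a vertex is reached from at least one source. *)
Definition theta (v : box nu) : option (box nu) :=
  [pick u | [&& source u, connect edge u v
              & [forall w, source w && connect edge w v ==>
                   (shifted_content u <= shifted_content w)]]].

Definition lambda : seq nat :=
  sort geq [seq #|(C : {set box nu})|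
           | C <- enum (preim_partition theta [set: box nu])].

End LLTGraph.

Definition mesym_part (N : nat) (K : fieldType) (s : seq nat) : {mpoly K[N]} :=
  \prod_(i <- s) mesym N K i.

(* The field Q(q) and its indeterminate. *)
Notation Qq := {fraction {poly rat}}.
Definition qvar : Qq := tofrac ('X : {poly rat}).

(* Main.v *)
Require Import Defs.
From mathcomp Require Import all_boot all_order all_algebra.
From mathcomp Require Import fraction mpoly.
From mathcomp Require Import ring zify.

(** Put t = q + 1.  A filling decreases strictly along the type I edges, and
    t ^ inv is the sum of q ^ #|E| over the sets E of double edges whose tail
    has a larger entry than their head.  So LLT (q + 1) is the sum, over all
    sets E of double edges, of q ^ #|E| times the generating function of the
    colourings that decrease strictly along G^E.  The latter is not
    e_lambda(G^E): only the totals over E agree, and this is the main point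
    (strict_color_class_sum).  It is proved as follows.

    Type I edges.  Making an edge double, minus deleting it, equals q times
    making it strict, both for colourings and for the sum of q ^ #|E| times
    e_lambda.  So the type I edges can be traded away, as long as all the sets
    of arcs that occur are interval-closed (dyck): with an arc (u, w), they
    contain every pair of vertices that lies between u and w.

    Recursion.  Let m be the vertex of smallest label.  Its class in a set E of
    arcs is what can be reached from m; no arc of E leaves it, and the other
    classes are those of E outside it.  Summing over E with a given class
    m |: A yields rooted_weight m A * t ^ #(arcs into A from outside the class)
    * e_(#|A| + 1) times the sum for the remaining vertices (class_sum_root).
    The coloured sum satisfies the same recursion (colored_rooted), hence the
    two agree.

    The coloured recursion is proved by induction on the number of colours,
    peeling off the largest one.  The induction needs companion identities with
    e_(#|A| - d) in place of e_(#|A| + 1), and its step reduces to one identity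
    for a root m and a set U of vertices above it (rooted_exchange).  Expand
    rooted_weight by inclusion-exclusion: each vertex of A carries one of two
    letters of opposite weights w and - w, and the vertices outside A carry a
    third letter.  The sum over words in two letters does not depend on which
    of the two counts as larger (cut_out_in, where interval-closedness enters),
    so the letter - w can be moved next to the letter w, and there the two
    cancel (alt_wt_sum).

    Cumulants.  A product of LLT polynomials over the blocks of a set partition
    P of the colours is the same sum over E, restricted to the E without double
    edges between distinct blocks (prod_LLT).  Exchanging the sums, E gets the
    coefficient \sum_P (-1) ^ (#|P| - 1) (#|P| - 1)!, over the P that are
    coarser than the components of the contracted graph.  It is 1 if that graph
    is connected and 0 otherwise (stable_partition_sum). *)

Set Implicit Arguments.
Unset Strict Implicit.
Unset Printing Implicit Defensive.

Import Order.TTheory GRing.Theory Num.Theory.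
Local Open Scope ring_scope.

(** * Sums over the subsets of a set *)

(** Inclusions, disjointness and non-membership are boolean constraints on the
    membership bits of one element, so that a set identity under such
    hypotheses is decided by cases on these bits ([set_tac]). *)
Lemma notin_bits (T : finType) (m v : T) (U : {set T}) :
  m \notin U -> (v == m) ==> (v \notin U).
Proof. by move=> mU; apply/implyP => /eqP->. Qed.

Lemma disjoint_bits (T : finType) (v : T) (A B : {set T}) :
  [disjoint A & B] -> ~~ ((v \in A) && (v \in B)).
Proof. by move/pred0P/(_ v)=> /= ->. Qed.

Lemma subset_bits (T : finType) (v : T) (A B : {set T}) :
  A \subset B -> (v \in A) ==> (v \in B).
Proof. by move/subsetP/(_ v)/implyP. Qed.

Ltac set_bits v :=
  repeat match goal with
  | H : is_true (subset _ _) |- _ => move: (subset_bits v H); clear H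
  | H : is_true [disjoint _ & _] |- _ => move: (disjoint_bits v H); clear H
  | H : is_true (_ \notin _) |- _ => move: (notin_bits v H); clear H
  end;
  rewrite ?inE /=;
  repeat match goal with
  | |- context [v \in ?X] => case: (v \in X)
  | |- context [v == ?x] => case: (v == x)
  end; try by [].

Ltac set_tac :=
  let v := fresh "v" in
  match goal with
  | |- @eq {set _} _ _ => apply/setP => v; set_bits v
  | |- is_true (subset _ _) =>
      apply/subsetP => v; apply/implyP; set_bits v
  | |- is_true [disjoint _ & _] =>
      apply/pred0P => v /=; set_bits v
  end.

Section SubsetSums.
Variables (T : finType) (R : nmodType).
Implicit Types (A B C U X Y : {set T}).

Lemma sum_subsetU X Y (f : {set T} -> R) : [disjoint X & Y] ->
  \sum_(E : {set T} | E \subset X :|: Y) f E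
  = \sum_(A : {set T} | A \subset X) \sum_(B : {set T} | B \subset Y) f (A :|: B).
Proof.
move=> dXY; rewrite pair_big /=.
rewrite (reindex_onto (fun p : {set T} * {set T} => p.1 :|: p.2)
           (fun E => (E :&: X, E :&: Y))) /=; last first.
  by move=> E sE; rewrite -setIUr; apply/setIidPl.
apply: eq_bigl => -[A B] /=; apply/andP/andP => [[sAB /eqP[<- <-]]|[sA sB]].
  by rewrite !subsetIr.
split; first exact: setUSS.
rewrite !setIUl (setIidPl sA) (setIidPl sB) xpair_eqE.
have -> : B :&: X = set0.
  by apply/eqP; rewrite setI_eq0 disjoint_sym; apply: disjointWr dXY.
have -> : A :&: Y = set0.
  by apply/eqP; rewrite setI_eq0; apply: disjointWl dXY.
by rewrite setU0 set0U !eqxx.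
Qed.

Lemma sum_subset0 (f : {set T} -> R) : \sum_(E : {set T} | E \subset set0) f E = f set0.
Proof. by rewrite (big_pred1 set0) // => E; rewrite subset0. Qed.

Lemma sum_subsetU1 x X (f : {set T} -> R) : x \notin X ->
  \sum_(E : {set T} | E \subset x |: X) f E
  = \sum_(E : {set T} | E \subset X) f E + \sum_(E : {set T} | E \subset X) f (x |: E).
Proof.
move=> xX; rewrite sum_subsetU ?disjoints1 //.
under eq_bigl => A do rewrite subset1.
rewrite (bigD1 [set x]) ?eqxx //= addrC; congr (_ + _).
rewrite (big_pred1 set0) => [|A]; first by under eq_bigr do rewrite set0U.
rewrite /= andb_orl andbN orFb; case: eqP => //= ->.
by apply/eqP => /setP/(_ x); rewrite !inE eqxx.
Qed.

(** Ordered pairs of disjoint sets can be enumerated by their union. *)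
Lemma sum_subset_union U (f : {set T} -> {set T} -> R) :
  \sum_(A : {set T} | A \subset U) \sum_(B : {set T} | B \subset U :\: A) f A B
  = \sum_(C : {set T} | C \subset U) \sum_(A : {set T} | A \subset C) f A (C :\: A).
Proof.
rewrite !pair_big_dep /=.
rewrite (reindex_onto (fun p : {set T} * {set T} => (p.2, p.1 :\: p.2))
           (fun p => (p.1 :|: p.2, p.1))) /=; last first.
  move=> [A B] /andP[_ /=]; rewrite subsetD => /andP[_ dBA].
  by rewrite setDUl setDv set0U (setDidPl dBA).
apply: eq_bigl => -[C A] /=; apply/idP/idP.
  case/andP=> /andP[sA sB] /eqP[eC]; rewrite -{2}eC subsetUl andbT -eC subUset sA.
  by apply: subset_trans sB _; apply: subsetDl.
case/andP=> sC sA; rewrite (subset_trans sA sC) setSD //=.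
by rewrite setDE setUIr setUCr setIT (setUidPr sA).
Qed.

Lemma sum_subset_exchange U (f : {set T} -> {set T} -> R) :
  \sum_(A : {set T} | A \subset U) \sum_(B : {set T} | B \subset U :\: A) f A B
  = \sum_(B : {set T} | B \subset U) \sum_(A : {set T} | A \subset U :\: B) f A B.
Proof.
rewrite (exchange_big_dep (fun B => B \subset U)) /=; last first.
  by move=> A B _; rewrite subsetD => /andP[].
apply: eq_bigr => B sB; apply: eq_bigl => A.
by rewrite !subsetD sB disjoint_sym.
Qed.
End SubsetSums.

Lemma sum_subset_prod (T : finType) (R : comPzRingType) (Z : {set T}) (g : T -> R) :
  \sum_(K : {set T} | K \subset Z) \prod_(v in K) g v = \prod_(v in Z) (1 + g v).
Proof.
elim: {Z}_.+1 {-2}Z (ltnSn #|Z|) => // n IHn Z leZ.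
have [->|[v vZ]] := set_0Vmem Z; first by rewrite sum_subset0 !big_set0.
rewrite -(setD1K vZ) sum_subsetU1 ?setD11 // big_setU1 ?setD11 //=.
rewrite mulrDl mul1r -IHn; last by rewrite (cardsD1 v) vZ in leZ.
rewrite big_distrr /=; congr (_ + _); apply: eq_bigr => K sK.
by rewrite big_setU1 //; apply: contraL sK => vK; apply/subsetPn; exists v; rewrite ?setD11.
Qed.

(** * Sets of labelled vertices *)

Section LabelledSets.
Variables (V : finType) (lab : V -> int).
Hypothesis lab_inj : injective lab.
Implicit Types (W : {set V}).

Lemma set_minP W : W != set0 -> exists m, exists W',
  [/\ W = m |: W', m \notin W' & forall v, v \in W' -> lab m < lab v].
Proof.
case/set0Pn => v0 v0W; case: (arg_minP lab v0W) => m mW min_m.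
exists m, (W :\ m); rewrite setD1K // setD11; split=> // v /setD1P[vm vW].
by rewrite lt_neqAle (min_m _ vW) andbT; apply: contra vm => /eqP /lab_inj ->.
Qed.

Lemma set_ind_min (P : {set V} -> Prop) : P set0 ->
  (forall m W, m \notin W -> (forall v, v \in W -> lab m < lab v) ->
     (forall W', (#|W'| <= #|W|)%N -> P W') -> P (m |: W)) ->
  forall W, P W.
Proof.
move=> P0 PS W; elim: {W}_.+1 {-2}W (ltnSn #|W|) => // n IHn W leW.
have [->//|/set_minP[m [W' [defW mW' ltm]]]] := eqVneq W set0.
rewrite defW; apply: PS => // W2 leW2; apply: IHn; apply: leq_ltn_trans leW2 _.
by move: leW; rewrite defW cardsU1 mW'.
Qed.

Lemma set_ind_max (P : {set V} -> Prop) : P set0 ->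
  (forall m W, m \notin W -> (forall v, v \in W -> lab v < lab m) ->
     P W -> P (m |: W)) ->
  forall W, P W.
Proof.
move=> P0 PS W; elim: {W}_.+1 {-2}W (ltnSn #|W|) => // n IHn W leW.
have [->//|/set0Pn[v0 v0W]] := eqVneq W set0.
case: (arg_maxP lab v0W) => m; rewrite -/(m \in W) => mW max_m; rewrite -(setD1K mW).
apply: PS; first by rewrite setD11.
  move=> v /setD1P[vm vW]; rewrite lt_neqAle; apply/andP; split; last exact: max_m.
  by apply: contra vm => /eqP /lab_inj ->.
by apply: IHn; move: leW; rewrite (cardsD1 m W) mW.
Qed.

Definition below W v := [set u in W | lab u < lab v].

Lemma below_max m W : m \notin W -> (forall v, v \in W -> lab v < lab m) ->
  below (m |: W) m = W.
Proof.
move=> mW ltm; apply/setP => v; rewrite !inE; case: eqP => [->|_] /=.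
  by rewrite ltxx (negPf mW).
by apply/andP/idP => [[]|vW] //; rewrite vW ltm.
Qed.

Lemma belowU1 m W v : lab v < lab m -> below (m |: W) v = below W v.
Proof.
move=> ltvm; apply/setP => u; rewrite !inE; case: eqP => [->|] //=.
by rewrite (lt_gtF ltvm) andbF.
Qed.

(** The numbers #|below W v|, for v in W, are 0, ..., #|W| - 1; this and
    [sum_rank] are a telescoping product and a telescoping sum over them. *)
Lemma prod_rank (R : comPzRingType) (f : nat -> R) W :
  \prod_(v in W) f #|below W v|.+1 * f 0%N = f #|W| * \prod_(v in W) f #|below W v|.
Proof.
elim/set_ind_max: W => [|m W mW ltm IH]; first by rewrite !big_set0 cards0 mulrC.
rewrite !(big_setU1 _ mW) /= below_max // cardsU1 mW add1n.
under eq_bigr => v vW do rewrite belowU1 ?ltm //.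
under [in RHS]eq_bigr => v vW do rewrite belowU1 ?ltm //.
by rewrite -mulrA IH.
Qed.

Lemma sum_rank (R : comPzRingType) (t : R) W :
  t ^+ #|W| - 1 = \sum_(v in W) (t - 1) * t ^+ #|below W v|.
Proof.
elim/set_ind_max: W => [|m W mW ltm IH]; first by rewrite !big_set0 cards0 subrr.
rewrite !(big_setU1 _ mW) /= below_max // cardsU1 mW add1n.
under eq_bigr => v vW do rewrite belowU1 ?ltm //.
by rewrite -IH exprS; ring.
Qed.

(** * Interval-closed sets of arcs *)

Section Edges.
Variables (R : comPzRingType) (t : R) (D : {set V * V}).
Implicit Types (A B C Y Z U : {set V}).

Definition arc_weight A B : R := t ^+ #|D :&: setX A B|.
Local Notation wt := arc_weight.

(** Additivity of the number of arcs in either argument is the only way in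
    which weights are computed below. *)
Lemma wtUl A B C : [disjoint A & B] -> wt (A :|: B) C = wt A C * wt B C.
Proof.
move=> dAB; rewrite /arc_weight -exprD -cardsUI; congr (t ^+ _).
have -> : D :&: setX A C :&: (D :&: setX B C) = set0.
  apply/setP => -[u v]; rewrite !inE /=; apply/negP => /and4P[/and3P[_ uA _] _ uB _].
  by move/pred0P/(_ u): dAB; rewrite /= uA uB.
rewrite cards0 addn0; congr #|pred_of_set _|.
by apply/setP => -[u v]; rewrite !inE /=; do ![case: (_ \in _) => //=].
Qed.

Lemma wtUr A B C : [disjoint A & B] -> wt C (A :|: B) = wt C A * wt C B.
Proof.
move=> dAB; rewrite /arc_weight -exprD -cardsUI; congr (t ^+ _).
have -> : D :&: setX C A :&: (D :&: setX C B) = set0.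
  apply/setP => -[u v]; rewrite !inE /=; apply/negP => /and4P[/and3P[_ _ uA] _ _ uB].
  by move/pred0P/(_ v): dAB; rewrite /= uA uB.
rewrite cards0 addn0; congr #|pred_of_set _|.
by apply/setP => -[u v]; rewrite !inE /=; do ![case: (_ \in _) => //=].
Qed.

Lemma wt_none A B : (forall u v, u \in A -> v \in B -> (u, v) \notin D) -> wt A B = 1.
Proof.
move=> noD; rewrite /arc_weight (_ : D :&: _ = set0) ?cards0 //.
apply/setP => -[u v]; rewrite !inE /=; apply/negP => /and3P[uvD uA vB].
by move: (noD u v uA vB); rewrite uvD.
Qed.

Lemma wt0l B : wt set0 B = 1.
Proof. by apply: wt_none => u v; rewrite inE. Qed.

Lemma wt0r A : wt A set0 = 1.
Proof. by apply: wt_none => u v; rewrite !inE. Qed.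

Lemma wt1l u B : wt [set u] B = t ^+ #|[set v in B | (u, v) \in D]|.
Proof.
congr (t ^+ _); rewrite -(card_imset [set v in B | (u, v) \in D] (f := pair u)); last by move=> x y [].
apply: eq_card => -[x y]; rewrite !inE /=; apply/and3P/imsetP => [[xyD /eqP ex yB]|[v]].
  by exists y; rewrite ?inE ?yB -?ex.
by rewrite inE => /andP[vB uvD] [-> ->].
Qed.

Lemma wt1r v A : wt A [set v] = t ^+ #|[set u in A | (u, v) \in D]|.
Proof.
congr (t ^+ _); rewrite -(card_imset [set u in A | (u, v) \in D] (f := pair^~ v)); last by move=> x y [].
apply: eq_card => -[x y]; rewrite !inE /=; apply/and3P/imsetP => [[xyD xA /eqP ey]|[u]].
  by exists x; rewrite ?inE ?xA -?ey.
by rewrite inE => /andP[uB uvD] [-> ->].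
Qed.

Lemma wt_prodl A B : wt A B = \prod_(u in A) wt [set u] B.
Proof.
elim/set_ind_max: A => [|m W mW _ IH]; first by rewrite wt0l big_set0.
by rewrite wtUl ?disjoints1 // big_setU1 //= IH.
Qed.

Lemma wt_prodr A B : wt A B = \prod_(v in B) wt A [set v].
Proof.
elim/set_ind_max: B => [|m W mW _ IH]; first by rewrite wt0r big_set0.
by rewrite wtUr ?disjoints1 // big_setU1 //= IH.
Qed.

(** The arcs of a unit interval order, that is, the cells under a Dyck path. *)
Definition dyck := forall u w, (u, w) \in D -> lab u < lab w /\
  (forall u' w', lab u <= lab u' -> lab u' < lab w' -> lab w' <= lab w -> (u', w') \in D).

Hypothesis dyckD : dyck.

Lemma wt_down m A B : (forall v, v \in B -> lab m < lab v) -> A \subset B -> wt A [set m] = 1.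
Proof.
move=> ltm /subsetP sAB; apply: wt_none => u v uA /set1P->; apply/negP => /dyckD[lt _].
by move: (ltm _ (sAB _ uA)); rewrite lt_gtF.
Qed.

(** Two-letter words on Y with the vertices of S carrying the letter of weight
    y: the inverted arcs are those from S to its complement when that letter is
    the larger one, and those into S when it is the smaller one.  In the rooted
    versions, m carries the letter that makes its arcs count. *)
Definition cut_out y Y : R :=
  \sum_(S : {set V} | S \subset Y) y ^+ #|S| * wt S (Y :\: S).
Definition cut_in y Y : R :=
  \sum_(S : {set V} | S \subset Y) y ^+ #|S| * wt (Y :\: S) S.
Definition cut_out_root m y Y : R :=
  \sum_(S : {set V} | S \subset Y) y ^+ #|S| * wt (m |: S) (Y :\: S).
Definition cut_in_root m y Y : R :=
  \sum_(S : {set V} | S \subset Y) y ^+ #|S| * wt (m |: (Y :\: S)) S.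

Section Root.
Variables (m : V) (Y : {set V}).
Hypotheses (mY : m \notin Y) (ltm : forall v, v \in Y -> lab m < lab v).

Lemma notin_sub (S : {set V}) : S \subset Y -> m \notin S.
Proof. by move=> /subsetP sS; apply: contra mY => /sS. Qed.

Lemma setU1D_l (S : {set V}) : S \subset Y -> (m |: Y) :\: S = m |: (Y :\: S).
Proof.
move/notin_sub => mS; apply/setP => v; rewrite !inE; case: eqP => [->|] //=.
by rewrite mS.
Qed.

Lemma setU1D_r (S : {set V}) : (m |: Y) :\: (m |: S) = Y :\: S.
Proof.
apply/setP => v; rewrite !inE negb_or; case: eqP => [->|] //=.
by rewrite (negPf mY) andbF.
Qed.

Lemma cut_outU1 y : cut_out y (m |: Y) = cut_out y Y + y * cut_out_root m y Y.
Proof.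
rewrite /cut_out sum_subsetU1 //; congr (_ + _); last first.
  rewrite big_distrr /=; apply: eq_bigr => S sS.
  by rewrite setU1D_r cardsU1 notin_sub //= add1n exprS mulrA.
apply: eq_bigr => S sS; rewrite setU1D_l // wtUr ?(wt_down ltm) ?mul1r //.
by rewrite disjoints1 inE negb_and mY orbT.
Qed.

Lemma cut_inU1 y : cut_in y (m |: Y) = cut_in_root m y Y + y * cut_in y Y.
Proof.
rewrite /cut_in sum_subsetU1 //; congr (_ + _).
  by apply: eq_bigr => S sS; rewrite setU1D_l.
rewrite big_distrr /=; apply: eq_bigr => S sS.
rewrite setU1D_r cardsU1 notin_sub //= add1n exprS wtUr ?disjoints1 ?notin_sub //.
by rewrite (wt_down ltm) ?subsetDl // mul1r mulrA.
Qed.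
End Root.

Section Neighbours.
Variables (m : V) (W : {set V}).
Hypotheses (mW : m \notin W) (ltm : forall v, v \in W -> lab m < lab v).
Let N := [set k in W | (m, k) \in D].

(** The neighbours of m form a clique, and they have no other in-neighbours in
    W than the neighbours of m below them. *)
Lemma nbr_in (A : {set V}) k : A \subset W -> k \in N ->
  [set u in A | (u, k) \in D] = below N k :&: A.
Proof.
move=> /subsetP sA; rewrite inE => /andP[kW mkD]; apply/setP => u; rewrite !inE.
case uA: (u \in A); rewrite ?andbF //= andbT (sA _ uA) /=.
have [_ itv] := dyckD mkD; apply/idP/andP => [ukD|[muD ltuk]].
  have ltuk := (dyckD ukD).1; split=> //.
  by apply: itv; rewrite ?lexx ?ltm ?sA // ltW.
by apply: itv; rewrite ?lexx // ltW // ltm // sA.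
Qed.

Lemma wt_root_sub1 (A : {set V}) : A \subset W ->
  wt [set m] A - 1 = \sum_(k in N | k \in A) (t - 1) * t ^+ #|below (N :&: A) k|.
Proof.
move=> /subsetP sA; rewrite wt1l (_ : [set _ in _ | _] = N :&: A); last first.
  by apply/setP => u; rewrite !inE; case uA: (u \in A); rewrite ?andbF // sA // andbT.
by rewrite sum_rank; apply: eq_bigl => k; rewrite inE.
Qed.

(** Single out the arc from m to its neighbour k, and sort by k the terms in
    which this arc contributes last.  Each vertex strictly between m and k then
    contributes exactly one arc with m or k whatever its letter is, so m and k
    can be removed at the cost of a constant factor.  The same happens in
    [cut_in_root_sub], with the same factor. *)
Lemma cut_out_root_sub y :
  cut_out_root m y W - cut_out y W
  = \sum_(k in N) (t - 1) * t ^+ #|below N k| * cut_out y (W :\ k).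
Proof.
rewrite /cut_out_root /cut_out -sumrB.
transitivity (\sum_(S : {set V} | S \subset W) \sum_(k in N | k \in W :\: S)
    (t - 1) * t ^+ #|below (N :&: (W :\: S)) k| * (y ^+ #|S| * wt S (W :\: S))).
  apply: eq_bigr => S sS; rewrite -big_distrl /= -wt_root_sub1 ?subsetDl //.
  by rewrite wtUl ?disjoints1 ?(notin_sub mW) //; ring.
rewrite (exchange_big_dep (mem N)) /=; last by move=> S k _ /andP[].
apply: eq_bigr => k kN; rewrite big_distrr /=; apply: eq_big => [S|S].
  have kW : k \in W by move: kN; rewrite inE => /andP[].
  by rewrite kN in_setD kW andbT subsetD1.
case/andP => sS /andP[_ kWS].
have -> : W :\: S = k |: ((W :\ k) :\: S).
  by rewrite -{1}(setD1K kWS); congr (_ |: _); apply/setP => v; rewrite !inE andbCA.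
rewrite (wtUr _ (A := [set k])) ?disjoints1 ?inE ?eqxx ?andbF //.
rewrite wt1r nbr_in //.
(* A vertex between m and k gives an arc from m if it is outside S, and an arc
   to k if it is in S. *)
have -> : #|below N k| = (#|below (N :&: (k |: (W :\ k) :\: S)) k| + #|below N k :&: S|)%N.
  rewrite addnC -(cardsID S (below N k)); congr (_ + _)%N; apply: eq_card => v.
  rewrite !inE; case vS: (v \in S) => /=; rewrite ?andbF ?orbF //=.
    by case: eqP => [ev|]; rewrite ?andbF // -?ev; move: kWS; rewrite inE -ev vS.
  case: eqP => [->|_] /=; first by rewrite ltxx !andbF.
  by case: (v \in W) => //=; rewrite ?andbF ?andbT.
by rewrite exprD; ring.
Qed.

Lemma cut_in_root_sub y :
  cut_in_root m y W - cut_in y W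
  = y * \sum_(k in N) (t - 1) * t ^+ #|below N k| * cut_in y (W :\ k).
Proof.
rewrite /cut_in_root /cut_in -sumrB.
transitivity (\sum_(S : {set V} | S \subset W) \sum_(k in N | k \in S)
    (t - 1) * t ^+ #|below (N :&: S) k| * (y ^+ #|S| * wt (W :\: S) S)).
  apply: eq_bigr => S sS; rewrite -big_distrl /= -wt_root_sub1 //.
  by rewrite wtUl ?disjoints1 ?inE ?(negPf mW) ?andbF //; ring.
rewrite (exchange_big_dep (mem N)) /=; last by move=> S k _ /andP[].
rewrite big_distrr /=; apply: eq_bigr => k kN.
have kW : k \in W by move: kN; rewrite inE => /andP[].
rewrite mulrA big_distrr /=.
rewrite (reindex_onto (fun S => k |: S) (fun S => S :\ k)) /=; last first.
  by move=> S /and3P[_ _ kS]; rewrite setD1K.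
apply: eq_big => [S|S].
  rewrite kN setU11 subUset sub1set kW subsetD1 !andbT /=; congr (_ && _).
  apply/eqP/idP => [<-|kS]; first by rewrite setD11.
  by rewrite setU1K.
case/andP => /and3P[sS _ _] /eqP eS; have kS : k \notin S by rewrite -eS setD11.
have -> : W :\: (k |: S) = (W :\ k) :\: S by apply/setP => v; rewrite !inE negb_or andbA (andbC (v != k)) -andbA.
rewrite wtUr ?disjoints1 // cardsU1 kS add1n wt1r nbr_in; last first.
- exact: kN.
- by apply: subset_trans (subsetDl _ _) _; apply: subsetDl.
have -> : #|below N k| = (#|below (N :&: (k |: S)) k| + #|below N k :&: ((W :\ k) :\: S)|)%N.
  rewrite -(cardsID S (below N k)); congr (_ + _)%N; apply: eq_card => v.
    rewrite !inE; case: eqP => [->|_] /=; first by rewrite ltxx !andbF.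
    by rewrite -!andbA; congr (_ && (_ && _)); rewrite andbC.
  rewrite !inE; case: eqP => [->|_] /=; first by rewrite ltxx !andbF.
  by case: (v \in W); case: (v \in S); rewrite ?andbF ?andbT.
by rewrite exprD exprS; ring.
Qed.
End Neighbours.

(** Symmetry in two letters. *)
Lemma cut_out_in y Y : cut_out y Y = cut_in y Y.
Proof.
elim/set_ind_min: Y => [|m W mW ltm IH].
  by rewrite /cut_out /cut_in !sum_subset0 setD0.
rewrite cut_outU1 // cut_inU1 // (IH W) //.
have := cut_out_root_sub mW ltm y; rewrite (IH W) // => eqD.
have := cut_in_root_sub mW ltm y.
under eq_bigr => k kN.
  rewrite -(IH (W :\ k)); first over.
  by apply: subset_leq_card; apply: subsetDl.
by rewrite -eqD => /eqP; rewrite subr_eq => /eqP->; ring.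
Qed.

(** The indegrees and the outdegrees agree as multisets.  Adding a smallest
    vertex m with p neighbours adds p to the outdegrees; it adds 0 to the
    indegrees and turns those of the neighbours of m, which are 0, ..., p - 1,
    into 1, ..., p. *)
Lemma outdeg_indeg (f : nat -> R) Z :
  \prod_(v in Z) f #|[set u in Z | (v, u) \in D]|
  = \prod_(v in Z) f #|[set u in Z | (u, v) \in D]|.
Proof.
elim/set_ind_min: Z => [|m W mW ltm IH]; first by rewrite !big_set0.
have noD v : v \in m |: W -> (v, m) \notin D.
  move=> vW; apply/negP => /dyckD[]; case/setU1P: vW => [->|/ltm lt]; first by rewrite ltxx.
  by rewrite (lt_gtF lt).
pose N := [set k in W | (m, k) \in D].
rewrite !big_setU1 //=.
have -> : [set u in m |: W | (m, u) \in D] = N.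
  by apply/setP => u; rewrite !inE; case: eqP => [->|] //=; rewrite (negPf (noD m _)) ?andbF ?setU11.
have -> : [set u in m |: W | (u, m) \in D] = set0.
  by apply/setP => u; rewrite !inE -in_setU1; apply/negP => /andP[/noD/negP].
rewrite cards0 (eq_bigr (fun v => f #|[set u in W | (v, u) \in D]|)); last first.
  move=> v vW; congr (f #|pred_of_set _|); apply/setP => u; rewrite !inE.
  by case: eqP => [->|] //=; rewrite (negPf (noD v _)) ?andbF // setU1r.
rewrite IH // (bigID (mem N)) /= [in RHS](bigID (mem N)) /= !mulrA; congr (_ * _); last first.
  apply: eq_bigr => v /andP[vW vN]; congr (f #|pred_of_set _|); apply/setP => u; rewrite !inE.
  case: eqP => [->|] //=; by move: vN; rewrite inE vW /= => /negPf->; rewrite ?andbF.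
have sub (g : V -> R) : \prod_(v in W | v \in N) g v = \prod_(v in N) g v.
  by apply: eq_bigl => v; rewrite !inE andbA andbb.
rewrite !sub.
rewrite (eq_bigr (fun v => f #|below N v|)); last first.
  move=> v vN; rewrite (nbr_in ltm) //; congr (f #|pred_of_set _|).
  by apply/setIidPl/subsetP => u; rewrite !inE => /andP[/andP[]].
rewrite -prod_rank mulrC; congr (_ * _); apply: eq_bigr => v vN; congr (f _).
have := vN; rewrite inE => /andP[vW mvD].
have -> : [set u in m |: W | (u, v) \in D] = m |: [set u in W | (u, v) \in D].
  by apply/setP => u; rewrite !inE; case: eqP => [->|] //=; rewrite mvD.
rewrite cardsU1 inE (negPf mW) add1n (nbr_in ltm) //; congr (#|pred_of_set _|.+1).
by symmetry; apply/setIidPl/subsetP => u; rewrite !inE => /andP[/andP[]].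
Qed.

Lemma in_out_sum w Z :
  \sum_(K : {set V} | K \subset Z) w ^+ #|K| * wt K Z
  = \sum_(K : {set V} | K \subset Z) w ^+ #|K| * wt Z K.
Proof.
transitivity (\prod_(v in Z) (1 + w * wt [set v] Z)).
  rewrite -sum_subset_prod; apply: eq_bigr => K _.
  by rewrite big_split prodr_const -wt_prodl.
transitivity (\prod_(v in Z) (1 + w * wt Z [set v])).
  under eq_bigr do rewrite wt1l.
  under [in RHS]eq_bigr do rewrite wt1r.
  exact: (outdeg_indeg (fun j => 1 + w * t ^+ j)).
rewrite -sum_subset_prod; apply: eq_bigr => K _.
by rewrite big_split prodr_const -wt_prodr.
Qed.

(** By inclusion-exclusion, the sum of (t - 1) ^ #|E| over the sets E of arcs
    on m |: A for which every vertex of A has an incoming arc, which means that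
    it can be reached from m. *)
Definition rooted_weight m A : R :=
  \sum_(K : {set V} | K \subset A) (-1) ^+ #|A :\: K| * wt (m |: A) K.

(** * The exchange identity for rooted weights *)

Section Insertion.
Variables (m : V) (U : {set V}) (w : R).
Hypotheses (mU : m \notin U) (ltm : forall v, v \in U -> lab m < lab v).

Lemma exp_sign (A K : {set V}) : K \subset A ->
  w ^+ #|A| * (-1) ^+ #|A :\: K| = w ^+ #|K| * (- w) ^+ #|A :\: K|.
Proof.
move=> sKA; rewrite -(cardsID K A) (setIidPr sKA) exprD (exprNn w); ring.
Qed.

(** The vertices of K are those with the letter w.  It is smaller than all the
    other letters and counts arcs between equal letters, so all arcs into K
    count and K decouples from the rest. *)
Lemma rooted_in_expand :
  \sum_(A : {set V} | A \subset U) w ^+ #|A| * (rooted_weight m A * wt (U :\: A) A)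
  = \sum_(K : {set V} | K \subset U)
      w ^+ #|K| * wt (m |: U) K * cut_in (- w) (U :\: K).
Proof.
pose F (K M : {set V}) : R := w ^+ #|K| * (- w) ^+ #|M| * (wt (m |: (K :|: M)) K * wt (U :\: (K :|: M)) (K :|: M)).
transitivity (\sum_(A : {set V} | A \subset U) \sum_(K : {set V} | K \subset A) F K (A :\: K)).
  apply: eq_bigr => A sA; rewrite mulrCA /rooted_weight big_distrl /=.
  apply: eq_bigr => K sK; rewrite /F (_ : K :|: A :\: K = A); last by set_tac.
  by rewrite -exp_sign //; ring.
rewrite -sum_subset_union; apply: eq_bigr => K sK.
rewrite /cut_in big_distrr /=; apply: eq_bigr => M; rewrite subsetD => /andP[sM dMK].
have dKM : [disjoint K & M] by rewrite disjoint_sym.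
have -> : U :\: K :\: M = U :\: (K :|: M) by set_tac.
rewrite /F wtUr //.
have -> : wt (m |: U) K = wt (m |: (K :|: M)) K * wt (U :\: (K :|: M)) K.
  by rewrite -wtUl; [congr (wt _ _); set_tac|set_tac].
ring.
Qed.

(** Here the letter w starts out above the letter of the vertices outside A;
    by [in_out_sum] it can be moved to the bottom, where K decouples as in
    [rooted_in_expand]. *)
Lemma rooted_out_expand :
  \sum_(A : {set V} | A \subset U) w ^+ #|A| * (rooted_weight m A * wt (m |: A) (U :\: A))
  = \sum_(K : {set V} | K \subset U)
      w ^+ #|K| * wt (m |: U) K * cut_out_root m (- w) (U :\: K).
Proof.
pose F (K M : {set V}) : R := w ^+ #|K| * (- w) ^+ #|M| * (wt (m |: (K :|: M)) K * wt (m |: (K :|: M)) (U :\: (K :|: M))).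
transitivity (\sum_(A : {set V} | A \subset U) \sum_(K : {set V} | K \subset A) F K (A :\: K)).
  apply: eq_bigr => A sA; rewrite mulrCA /rooted_weight big_distrl /=.
  apply: eq_bigr => K sK; rewrite /F (_ : K :|: A :\: K = A); last by set_tac.
  by rewrite -exp_sign //; ring.
rewrite -sum_subset_union sum_subset_exchange.
transitivity (\sum_(M : {set V} | M \subset U) (- w) ^+ #|M| * wt (m |: M) (U :\: M) *
  \sum_(K : {set V} | K \subset U :\: M) w ^+ #|K| * wt K (U :\: M)).
  apply: eq_bigr => M sM; rewrite big_distrr /=; apply: eq_bigr => K sK; rewrite /F.
  have -> : wt (m |: (K :|: M)) K * wt (m |: (K :|: M)) (U :\: (K :|: M))
     = wt (m |: M) (U :\: M) * wt K (U :\: M).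
    rewrite -wtUr; last by set_tac.
    by rewrite -wtUl; [congr (wt _ _); set_tac|set_tac].
  ring.
under eq_bigr do rewrite in_out_sum big_distrr /=.
rewrite sum_subset_exchange; apply: eq_bigr => K sK.
rewrite /cut_out_root big_distrr /=; apply: eq_bigr => M sM.
have -> : U :\: M = K :|: (U :\: K :\: M) by set_tac.
rewrite wtUr; last by set_tac.
have -> : wt (m |: U) K = wt (m |: M) K * wt (K :|: (U :\: K :\: M)) K.
  by rewrite -wtUl; [congr (wt _ _); set_tac|set_tac].
ring.
Qed.

(** The vertex of smallest label in T has no incoming arc in T, so moving it in
    and out of K changes only the sign. *)
Lemma alt_wt_sum (T : {set V}) :
  \sum_(K : {set V} | K \subset T) (-1) ^+ #|T :\: K| * wt T K = (T == set0)%:R.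
Proof.
have [->|/set_minP[v [T' [-> vT' ltv]]]] := eqVneq T set0.
  by rewrite sum_subset0 wt0l setD0 cards0 mulr1.
rewrite sum_subsetU1 // -big_split big1 // => K sK /=.
have vK : v \notin K by apply: contra vT'; apply: (subsetP sK).
rewrite wtUr ?disjoints1 // [wt _ [set v]]wt_none ?mul1r; last first.
  move=> u w' uT /set1P->; apply/negP => /dyckD[ltuv _]; move: ltuv.
  by case/setU1P: uT => [->|/ltv /lt_gtF->//]; rewrite ltxx.
have -> : (v |: T') :\: (v |: K) = T' :\: K by set_tac.
have -> : (v |: T') :\: K = v |: (T' :\: K) by set_tac.
by rewrite cardsU1 inE (negPf vT') andbF add1n exprS; ring.
Qed.

(** The sums over A compare the letters of A, of total weight w - w = 0, to a
    third letter, which is larger in the first sum and smaller in the second.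
    On m |: U the root can itself carry the letter w or the third letter (first
    sum), or the letter - w (second sum): the left-hand side is the sum over all
    words on m |: U, in which the two cancelling letters can be dropped. *)
Lemma rooted_exchange :
  (1 + w) * (\sum_(A : {set V} | A \subset U) w ^+ #|A| * (rooted_weight m A * wt (U :\: A) A))
  - w * (\sum_(A : {set V} | A \subset U) w ^+ #|A| * (rooted_weight m A * wt (m |: A) (U :\: A)))
  = 1.
Proof.
rewrite rooted_in_expand rooted_out_expand !big_distrr -sumrB /=.
transitivity (\sum_(K : {set V} | K \subset U) \sum_(S : {set V} | S \subset U :\: K)
   w ^+ #|K| * (- w) ^+ #|S| * (wt (m |: U) K * wt (m |: (U :\: K :\: S)) S)).
  apply: eq_bigr => K sK; set Y := U :\: K.
  have mY : m \notin Y by rewrite inE (negPf mU) andbF.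
  have ltY v : v \in Y -> lab m < lab v by case/setDP => /ltm.
  (* Symmetry in the letter - w and the third letter, on m |: Y. *)
  transitivity (w ^+ #|K| * wt (m |: U) K * cut_in_root m (- w) Y).
    have := cut_out_in (- w) (m |: Y); rewrite cut_outU1 // cut_inU1 // cut_out_in => eqU.
    have -> : cut_in_root m (- w) Y
       = cut_in (- w) Y + - w * cut_out_root m (- w) Y - - w * cut_in (- w) Y.
      by rewrite eqU; ring.
    by ring.
  by rewrite /cut_in_root big_distrr /=; apply: eq_bigr => S _; ring.
(* The letters w on K and - w on S are now adjacent: they cancel on K :|: S. *)
pose F (K S : {set V}) : R := w ^+ #|K| * (- w) ^+ #|S| *
  (wt (m |: (U :\: (K :|: S))) (K :|: S) * wt (K :|: S) K).
transitivity (\sum_(K : {set V} | K \subset U) \sum_(S : {set V} | S \subset U :\: K) F K S).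
  apply: eq_bigr => K sK; apply: eq_bigr => S sS; rewrite /F; congr (_ * _).
  have -> : U :\: K :\: S = U :\: (K :|: S) by set_tac.
  have -> : wt (m |: U) K = wt (m |: (U :\: (K :|: S))) K * wt (K :|: S) K.
    by rewrite -wtUl; [congr (wt _ _); set_tac|set_tac].
  by rewrite wtUr; [ring|set_tac].
rewrite sum_subset_union (bigD1 set0) ?sub0set //= sum_subset0 big1 ?addr0.
  by rewrite /F set0D setU0 !cards0 wt0l wt0r !mulr1.
move=> T /andP[sT nT].
transitivity (w ^+ #|T| * wt (m |: (U :\: T)) T *
    \sum_(K : {set V} | K \subset T) (-1) ^+ #|T :\: K| * wt T K); last first.
  by rewrite alt_wt_sum (negPf nT) mulr0.
rewrite big_distrr /=; apply: eq_bigr => K sK; rewrite /F.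
have -> : K :|: T :\: K = T by set_tac.
by rewrite -exp_sign //; ring.
Qed.
End Insertion.
End Edges.
End LabelledSets.

(** * The recursion for the coloured sum *)

Section Llt.
Variables (V : finType) (lab : V -> int).
Hypothesis lab_inj : injective lab.
Variables (R : comNzRingType) (t : R) (D : {set V * V}).
Hypothesis dyckD : dyck lab D.
Implicit Types (A B C S W U : {set V}).

Lemma coef_card_sum (U : {set V}) (g : {set V} -> R) d :
  (\sum_(A : {set V} | A \subset U) 'X ^+ #|A| * (g A)%:P)`_d
  = \sum_(A : {set V} | (A \subset U) && (#|A| == d)) g A.
Proof.
rewrite coef_sum [in RHS]big_mkcondr; apply: eq_bigr => A _.
by rewrite mulrC mul_polyC coefZ coefXn eq_sym; case: eqP => _; rewrite ?mulr1 ?mulr0.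
Qed.

Local Notation wt := (arc_weight t D).
Local Notation rooted := (rooted_weight t D).

(** The coefficient of w ^ (d + 1) in [rooted_exchange]. *)
Lemma rooted_exchange_card m U d : m \notin U -> (forall v, v \in U -> lab m < lab v) ->
  \sum_(A : {set V} | (A \subset U) && (#|A| == d)) rooted m A * wt (m |: A) (U :\: A)
  = \sum_(A : {set V} | (A \subset U) && (#|A| == d)) rooted m A * wt (U :\: A) A
  + \sum_(A : {set V} | (A \subset U) && (#|A| == d.+1)) rooted m A * wt (U :\: A) A.
Proof.
move=> mU ltm; have := rooted_exchange lab_inj (t%:P) dyckD 'X mU ltm.
have wtP A B : arc_weight t%:P D A B = (wt A B)%:P by rewrite /arc_weight polyC_exp.
have treeP A : rooted_weight t%:P D m A = (rooted m A)%:P.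
  rewrite /rooted_weight rmorph_sum; apply: eq_bigr => K _.
  by rewrite /= wtP polyCM [((-1) ^+ _)%:P]polyC_exp polyCN.
under eq_bigr => A _ do rewrite treeP wtP -polyCM.
under [X in _ - _ * X]eq_bigr => A _ do rewrite treeP wtP -polyCM.
move/(congr1 (fun p : {poly R} => p`_d.+1)).
rewrite mulrDl mul1r coefB coefD !coefXM /= !coef_card_sum coef1 /=.
by move/eqP; rewrite subr_eq0 addrC => /eqP.
Qed.

Variable x : nat -> R.

(** Colourings of W by the colours 1, ..., n, weighted by t ^ inv: S is the set
    of vertices of the largest colour, whose arcs to the other vertices are all
    inverted. *)
Fixpoint colored n W : R :=
  if n is n'.+1 then
    \sum_(S : {set V} | S \subset W) x n ^+ #|S| * wt S (W :\: S) * colored n' (W :\: S)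
  else (W == set0)%:R.

Fixpoint elem n k : R :=
  if n is n'.+1 then elem n' k + (if k is k'.+1 then x n * elem n' k' else 0)
  else (k == 0%N)%:R.

(** e_(a - d), which is zero for a < d. *)
Definition elem_sub n a d := if (d <= a)%N then elem n (a - d)%N else 0.

Lemma elem_subS n a d : elem_sub n.+1 a d = elem_sub n a d + x n.+1 * elem_sub n a d.+1.
Proof.
rewrite /elem_sub; case: (ltngtP d a) => [lt|_|->]; rewrite ?mulr0 ?addr0 //.
  by have -> : (a - d = (a - d.+1).+1)%N by lia.
by rewrite subnn /= addr0.
Qed.

Section Root.
Variable m : V.

(** Induction on n, with S the set of vertices of colour n + 1: writing
    e_k in n + 1 variables as e_k + x e_(k - 1) makes the cases d and d + 1 for n
    appear together, and [rooted_exchange_card] on A :|: S merges them. *)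
Lemma colored_rooted_shift n d W : m \notin W -> (forall v, v \in W -> lab m < lab v) ->
  \sum_(A : {set V} | A \subset W)
     rooted m A * wt (W :\: A) A * elem_sub n #|A| d * colored n (W :\: A)
  = \sum_(A : {set V} | (A \subset W) && (#|A| == d))
     rooted m A * wt (m |: A) (W :\: A) * colored n (W :\: A).
Proof.
elim: n d W => [|n IHn] d W mW ltm.
  rewrite [in RHS]big_mkcondr; apply: eq_bigr => A sA /=.
  case: (eqVneq (W :\: A) set0) => [->|_]; last by rewrite !mulr0 if_same.
  rewrite wt0l wt0r !mulr1 /elem_sub /=.
  have -> : (if (d <= #|A|)%N then ((#|A| - d)%N == 0%N)%:R else 0) = (#|A| == d)%:R :> R.
    by case: leqP => [le|/ltn_eqF->//]; rewrite subn_eq0 eqn_leq le andbT.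
  by case: eqP => _; rewrite ?mulr1 ?mulr0.
(* The summand, with W split into A, S and the rest; the factor s is x for the
   terms with d + 1. *)
pose h A S (s : R) := s * x n.+1 ^+ #|S| * (rooted m A * wt S A) *
   wt (m |: (A :|: S)) (W :\: (A :|: S)) * colored n (W :\: (A :|: S)).
transitivity (\sum_(S : {set V} | S \subset W)
    (\sum_(A : {set V} | (A \subset W :\: S) && (#|A| == d)) h A S 1
    + \sum_(A : {set V} | (A \subset W :\: S) && (#|A| == d.+1)) h A S (x n.+1))).
  transitivity (\sum_(S : {set V} | S \subset W) x n.+1 ^+ #|S| * wt S (W :\: S) *
   ((\sum_(A : {set V} | A \subset W :\: S)
       rooted m A * wt (W :\: S :\: A) A * elem_sub n #|A| d * colored n (W :\: S :\: A))
    + x n.+1 * (\sum_(A : {set V} | A \subset W :\: S)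
       rooted m A * wt (W :\: S :\: A) A * elem_sub n #|A| d.+1 * colored n (W :\: S :\: A)))).
    under eq_bigr => A sA do rewrite /= big_distrr /=.
    rewrite sum_subset_exchange; apply: eq_bigr => S sS.
    rewrite big_distrr -big_split big_distrr /=; apply: eq_bigr => A sA.
    rewrite elem_subS.
    have -> : W :\: A :\: S = W :\: S :\: A by set_tac.
    have -> : W :\: A = S :|: (W :\: S :\: A) by set_tac.
    rewrite wtUl; last by set_tac.
    have -> : wt S (W :\: S) = wt S A * wt S (W :\: S :\: A).
      by rewrite -wtUr; [congr (wt _ _); set_tac|set_tac].
    by ring.
  apply: eq_bigr => S sS.
  have mS : m \notin W :\: S by rewrite inE (negPf mW) andbF.
  have ltS v : v \in W :\: S -> lab m < lab v by case/setDP => /ltm.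
  rewrite !IHn // mulrDr mulrCA !big_distrr /=.
  have wtAS A : A \subset W :\: S -> wt (m |: (A :|: S)) (W :\: (A :|: S))
      = wt (m |: A) (W :\: (A :|: S)) * wt S (W :\: (A :|: S)).
    by move=> sA; rewrite -wtUl; [congr (wt _ _); set_tac|set_tac].
  have wtS A : A \subset W :\: S -> wt S (W :\: S) = wt S A * wt S (W :\: (A :|: S)).
    by move=> sA; rewrite -wtUr; [congr (wt _ _); set_tac|set_tac].
  have WSA A : W :\: S :\: A = W :\: (A :|: S) by set_tac.
  by congr (_ + _); apply: eq_bigr => A /andP[sA _]; rewrite /h WSA wtAS // (wtS A) //; ring.
transitivity (\sum_(C : {set V} | C \subset W) x n.+1 ^+ (#|C| - d) *
    wt (m |: C) (W :\: C) * colored n (W :\: C) *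
    (\sum_(A : {set V} | (A \subset C) && (#|A| == d)) rooted m A * wt (C :\: A) A
    + \sum_(A : {set V} | (A \subset C) && (#|A| == d.+1)) rooted m A * wt (C :\: A) A)).
  rewrite big_split /=.
  under eq_bigr do rewrite big_mkcondr.
  under [X in _ + X]eq_bigr do rewrite big_mkcondr.
  rewrite sum_subset_exchange [X in _ + X = _]sum_subset_exchange !sum_subset_union -big_split /=; apply: eq_bigr => C sC.
  rewrite mulrDr !big_distrr /= ![in RHS]big_mkcondr; congr (_ + _); apply: eq_bigr => A sA.
    case: eqP => // cA; rewrite /h (_ : A :|: C :\: A = C); last by set_tac.
    by rewrite cardsD (setIidPr sA) cA; ring.
  case: eqP => // cA; rewrite /h (_ : A :|: C :\: A = C); last by set_tac.
  have leC : (d < #|C|)%N by rewrite -cA subset_leq_card.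
  by rewrite cardsD (setIidPr sA) cA -[(#|C| - d)%N](@prednK) ?subn_gt0 // -subnS exprS; ring.
under eq_bigr => C sC.
  rewrite -rooted_exchange_card; [over| |].
  - by apply: contra mW; apply: (subsetP sC).
  - by move=> v vC; apply: ltm; apply: (subsetP sC).
under [in RHS]eq_bigr do rewrite /= big_distrr /=.
rewrite [in RHS]big_mkcondr /=.
transitivity (\sum_(A : {set V} | A \subset W) \sum_(S : {set V} | S \subset W :\: A)
    if #|A| == d then rooted m A * wt (m |: A) (W :\: A) *
       (x n.+1 ^+ #|S| * wt S (W :\: A :\: S) * colored n (W :\: A :\: S)) else 0); last first.
  by apply: eq_bigr => A sA; case: eqP => // _; rewrite big1.
rewrite sum_subset_union; apply: eq_bigr => C sC.
rewrite big_distrr /= big_mkcondr; apply: eq_bigr => A sA; case: eqP => // cA.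
have -> : W :\: A :\: (C :\: A) = W :\: C by set_tac.
have -> : wt (m |: C) (W :\: C) = wt (m |: A) (W :\: C) * wt (C :\: A) (W :\: C).
  by rewrite -wtUl; [congr (wt _ _); set_tac|set_tac].
have -> : wt (m |: A) (W :\: A) = wt (m |: A) (C :\: A) * wt (m |: A) (W :\: C).
  by rewrite -wtUr; [congr (wt _ _); set_tac|set_tac].
by rewrite cardsD (setIidPr sA) cA; ring.
Qed.

Lemma rooted0 : rooted m set0 = 1.
Proof. by rewrite /rooted_weight sum_subset0 setD0 cards0 wt0r mulr1. Qed.

(** The sets S of vertices of largest colour without m are matched by the case
    of n colours, and those that contain m by [colored_rooted_shift] for d = 0,
    where only A = set0 remains. *)
Lemma colored_rooted n W : m \notin W -> (forall v, v \in W -> lab m < lab v) ->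
  colored n (m |: W) = \sum_(A : {set V} | A \subset W)
     rooted m A * wt (W :\: A) A * elem n #|A|.+1 * colored n (W :\: A).
Proof.
elim: n W => [|n IHn] W mW ltm.
  rewrite big1 => [|A _]; last by rewrite /= mulr0 mul0r.
  by rewrite /= (negPf (_ : m |: W != set0)) //; apply/set0Pn; exists m; rewrite setU11.
transitivity (\sum_(S : {set V} | S \subset W) x n.+1 ^+ #|S| * wt S (W :\: S) *
   ((\sum_(A : {set V} | A \subset W :\: S)
       rooted m A * wt (W :\: S :\: A) A * elem n #|A|.+1 * colored n (W :\: S :\: A))
    + x n.+1 * (\sum_(A : {set V} | A \subset W :\: S)
       rooted m A * wt (W :\: S :\: A) A * elem_sub n #|A| 0 * colored n (W :\: S :\: A)))).
  rewrite /= sum_subsetU1 // -big_split /=; apply: eq_bigr => S sS.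
  have mS : m \notin W :\: S by rewrite inE (negPf mW) andbF.
  have ltS v : v \in W :\: S -> lab m < lab v by case/setDP => /ltm.
  rewrite -IHn // colored_rooted_shift // (big_pred1 set0) => [|A]; last first.
    by rewrite /= cards_eq0; case: eqP => [->|]; rewrite ?sub0set ?andbF.
  rewrite rooted0 mul1r !setD0 setU0.
  have mS' : m \notin S by rewrite (notin_sub mW).
  rewrite setU1D_l // setU1D_r // cardsU1 mS' add1n.
  rewrite wtUr; last by set_tac.
  rewrite (wt_down t dyckD ltm) // mul1r wtUl; last by set_tac.
  by rewrite exprS; ring.
under [RHS]eq_bigr => A sA do rewrite /= big_distrr /=.
rewrite sum_subset_exchange; apply: eq_bigr => S sS.
rewrite big_distrr -big_split big_distrr /=; apply: eq_bigr => A sA.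
rewrite /elem_sub /= subn0.
have -> : W :\: A :\: S = W :\: S :\: A by set_tac.
have -> : W :\: A = S :|: (W :\: S :\: A) by set_tac.
rewrite wtUl; last by set_tac.
have -> : wt S (W :\: S) = wt S A * wt S (W :\: S :\: A).
  by rewrite -wtUr; [congr (wt _ _); set_tac|set_tac].
by ring.
Qed.
End Root.
End Llt.

(** * The recursion for the sum over sets of arcs *)

Lemma sum_subset_compl (T : finType) (R : nmodType) (U : {set T}) (f : {set T} -> R) :
  \sum_(A : {set T} | A \subset U) f (U :\: A) = \sum_(A : {set T} | A \subset U) f A.
Proof.
rewrite [RHS](reindex_onto (setD U) (setD U)) /= => [|A sA]; last first.
  by rewrite setDDr setDv set0U; apply/setIidPr.
apply: eq_bigl => A; rewrite subsetDl setDDr setDv set0U.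
by apply/idP/eqP => [/setIidPr|<-] //; apply: subsetIl.
Qed.

Lemma sum_subset_exp (T : finType) (R : comPzRingType) (q : R) (X : {set T}) :
  \sum_(E : {set T} | E \subset X) q ^+ #|E| = (1 + q) ^+ #|X|.
Proof.
by rewrite -prodr_const -sum_subset_prod; apply: eq_bigr => E _; rewrite prodr_const.
Qed.

Section Classes.
Variables (V : finType) (lab : V -> int).
Hypothesis lab_inj : injective lab.
Implicit Types (G E D : {set V * V}) (A B Q W : {set V}).

Definition arc_rel G : rel V := fun u v => (u, v) \in G.

(** Equals theta whenever arcs increase labels: the smallest vertex from which v
    can be reached is then a source. *)
Definition min_root G v := [arg min_(u < v | connect (arc_rel G) u v) lab u]%O.

Lemma min_rootP G v : connect (arc_rel G) (min_root G v) v /\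
  forall u, connect (arc_rel G) u v -> lab (min_root G v) <= lab u.
Proof. by rewrite /min_root; case: arg_minP => [|u cu min_u]; [apply: connect0|split]. Qed.

Lemma min_root_eq G u v : connect (arc_rel G) u v ->
  (forall w, connect (arc_rel G) w v -> lab u <= lab w) -> min_root G v = u.
Proof.
move=> cu min_u; have [cr min_r] := min_rootP G v.
by apply: lab_inj; apply/eqP; rewrite eq_le min_r // min_u.
Qed.

Lemma connect_back G Q u v : (forall u v, (u, v) \in G -> v \in Q -> u \in Q) ->
  connect (arc_rel G) u v -> v \in Q -> u \in Q /\ connect (arc_rel (G :&: setX Q Q)) u v.
Proof.
move=> backQ /connectP[p]; elim: p u => [|w p IHp] u /= => [_ ->|].
  by split=> //; apply: connect0.
case/andP=> uw pathp eqv vQ; have [wQ cw] := IHp w pathp eqv vQ.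
have uQ := backQ _ _ uw wQ; split=> //.
by apply: connect_trans (connect1 _) cw; rewrite /arc_rel !inE /= uQ wQ !andbT.
Qed.

Lemma min_root_back G Q v : (forall u v, (u, v) \in G -> v \in Q -> u \in Q) ->
  v \in Q -> min_root G v = min_root (G :&: setX Q Q) v.
Proof.
move=> backQ vQ; have [cr min_r] := min_rootP (G :&: setX Q Q) v.
have sub : subrel (connect (arc_rel (G :&: setX Q Q))) (connect (arc_rel G)).
  by apply: connect_sub => a b; rewrite /arc_rel inE => /andP[ab _]; apply: connect1.
apply: min_root_eq => [|w /(connect_back backQ) /(_ vQ) []]; first exact: sub.
by move=> _; apply: min_r.
Qed.

Lemma min_root_in G Q v : (forall u v, (u, v) \in G -> v \in Q -> u \in Q) ->
  v \in Q -> min_root G v \in Q.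
Proof. by move=> backQ vQ; case: (connect_back backQ (min_rootP G v).1 vQ). Qed.

Variables (R : comNzRingType) (q : R) (e : nat -> R).
Hypothesis e0 : e 0%N = 1.

(** Vertices that are not roots contribute e 0, which is 1 below. *)
Definition class_prod G W : R := \prod_(u in W) e #|[set v in W | min_root G v == u]|.

Definition class_sum D W : R :=
  \sum_(E : {set V * V} | E \subset D :&: setX W W) q ^+ #|E| * class_prod E W.

Section Root.
Variables (D : {set V * V}) (m : V) (W : {set V}).
Hypotheses (mW : m \notin W) (ltm : forall v, v \in W -> lab m < lab v).
Hypothesis (ltD : forall u v, (u, v) \in D -> lab u < lab v).
Let U := m |: W.

Definition covered (P : {set V}) A E := [forall (v | v \in A), exists (u | u \in P), (u, v) \in E].

(** The class of m is m |: A if and only if no arc leaves m |: A and every vertex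
    of A has an incoming arc from m |: A: following such arcs backwards decreases
    labels, so it ends in m. *)
Lemma reach_covered A E : A \subset W ->
  (E \subset D :&: setX U U) && ([set v in W | connect (arc_rel E) m v] == A)
  = (E \subset D :&: setX U A :|: D :&: setX (W :\: A) (W :\: A)) && covered (m |: A) A E.
Proof.
move=> sA; apply/andP/andP => [[/subsetP sE /eqP defA]|[/subsetP sE /forallP covA]].
  have inA v : (v \in A) = (v \in W) && connect (arc_rel E) m v by rewrite -defA inE.
  have conn_mA u : u \in m |: A -> connect (arc_rel E) m u.
    by case/setU1P=> [->|]; rewrite ?connect0 // inA => /andP[].
  have inW u v : (u, v) \in E -> [/\ (u, v) \in D, u \in U & v \in W].
    move=> uvE; have := sE _ uvE; rewrite !inE /= => /and3P[uvD uU vU]; split=> //.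
    case/orP: vU => [/eqP ev|//]; have := ltD uvD; rewrite ev.
    by case/orP: uU => [/eqP->|/ltm /lt_gtF->//]; rewrite ltxx.
  split.
    apply/subsetP => -[u v] uvE; have [uvD uU vW] := inW _ _ uvE.
    move: uU; rewrite !inE uvD vW /= => uU; rewrite uU !andbT /=.
    case vA: (v \in A) => //=; rewrite andbC.
    case/orP: uU => [/eqP eu|uW]; last first.
      rewrite uW !andbT; apply: contraFN vA => uA; rewrite inA vW /=.
      apply: connect_trans (conn_mA u _) (connect1 _) => //; by rewrite setU1r.
    by case/negP: (negbT vA); rewrite inA vW; apply: connect1; rewrite -eu.
  apply/forallP => v; apply/implyP => vA; have := vA; rewrite inA => /andP[vW].
  case/connectP => p; elim/last_ind: p => [_ /= ev|p z _]; first by rewrite ev (negPf mW) in vW.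
  rewrite rcons_path last_rcons => /andP[pathp lz] ev; subst z.
  have lzE : (last m p, v) \in E := lz.
  apply/existsP; exists (last m p); rewrite lzE andbT; apply/setU1P.
  have [_ uU _] := inW _ _ lz; case/setU1P: uU => [->|uW]; [by left|right].
  by rewrite inA uW; apply/connectP; exists p.
split.
  apply/subsetP => -[u v] /sE; rewrite !inE /= -!andb_orr => /andP[-> /=].
  by case/orP=> [/andP[-> /(subsetP sA) ->]|/and3P[/andP[_ ->] _ ->]]; rewrite !orbT.
apply/eqP/setP => v; rewrite inE.
apply/andP/idP => [[vW /connectP[p]]|vA].
  suff : forall z, z \in m |: A -> path (arc_rel E) z p -> last z p \in m |: A.
    move=> H pathp ev; have := H m (setU11 _ _) pathp; rewrite -ev.
    by case/setU1P=> [em|//]; rewrite em (negPf mW) in vW.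
  elim: p => //= w p IHp z zA /andP[zw /IHp]; apply.
  have := sE _ zw; rewrite !inE; case/orP => [/and3P[_ _ ->]|]; first by rewrite orbT.
  case/and4P=> _ /andP[nzA zW] _ _; case/setU1P: zA => [ez|zA]; last by rewrite zA in nzA.
  by rewrite ez (negPf mW) in zW.
split; first exact: (subsetP sA).
have [k] := ubnP `|lab v - lab m|%N; elim: k v vA => // k IHk v vA lek.
have /existsP[u /andP[uA uvE]] := implyP (covA v) vA.
case/setU1P: uA => [<-|uA]; first exact: connect1.
apply: connect_trans (IHk u uA _) (connect1 uvE).
have uvD : (u, v) \in D by have := sE _ uvE; rewrite !inE -andb_orr => /andP[].
have := ltD uvD; have := ltm (subsetP sA _ uA); lia.
Qed.

(** Inclusion-exclusion over the set B of vertices of A without an incoming arc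
    from m |: A; the arcs from W :\: A to A are free. *)
Lemma covered_sum A : A \subset W ->
  \sum_(E : {set V * V} | E \subset D :&: setX U A) q ^+ #|E| * (covered (m |: A) A E)%:R
  = rooted_weight (1 + q) D m A * arc_weight (1 + q) D (W :\: A) A.
Proof.
move=> sA; set P := m |: A; pose hit (E : {set V * V}) (v : V) := [exists (u | u \in P), (u, v) \in E].
transitivity (\sum_(B : {set V} | B \subset A) (-1) ^+ #|B| *
   \sum_(E : {set V * V} | E \subset D :&: setX U A :\: setX P B) q ^+ #|E|).
  transitivity (\sum_(E : {set V * V} | E \subset D :&: setX U A) \sum_(B : {set V} | B \subset A)
      q ^+ #|E| * \prod_(v in B) - (~~ hit E v)%:R).
    apply: eq_bigr => E _; rewrite -big_distrr sum_subset_prod /=; congr (_ * _).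
    case: (boolP (covered P A E)) => [/forall_inP cov|].
      by rewrite big1 // => v /cov; rewrite -/(hit E v) => ->; rewrite subr0.
    rewrite negb_forall_in => /exists_inP[v vA nv].
    by rewrite (bigD1 v) //= nv subrr mul0r.
  rewrite exchange_big; apply: eq_bigr => B sB; rewrite big_distrr /=.
  rewrite [RHS](eq_bigl (fun E => (E \subset D :&: setX U A) && [forall (v | v \in B), ~~ hit E v])).
    rewrite [RHS]big_mkcondr; apply: eq_bigr => E _; case: ifPn => [/forall_inP nhit|].
      rewrite (eq_bigr (fun => -1)) ?prodr_const 1?mulrC // => v vB.
      by rewrite nhit.
    rewrite negb_forall_in => /exists_inP[v vB]; rewrite negbK => nv.
    by rewrite (bigD1 v) //= nv oppr0 mul0r mulr0.
  move=> E; rewrite subsetD; congr (_ && _); apply/pred0P/forallP => [dE v|nhit [u v] /=].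
    apply/implyP => vB; apply/negP => /existsP[u /andP[uP uvE]].
    by have := dE (u, v); rewrite /= inE uP vB uvE.
  apply/negP => /andP[uvE]; rewrite inE => /andP[uP vB].
  by have := implyP (nhit v) vB; case/negP; apply/existsP; exists u; rewrite uP.
rewrite /rooted_weight -[in RHS]sum_subset_compl big_distrl /=; apply: eq_bigr => B sB.
rewrite sum_subset_exp -mulrA setDDr setDv set0U (setIidPr sB); congr (_ * _).
rewrite /arc_weight -exprD -cardsUI; congr (_ ^+ _).
have -> : D :&: setX P (A :\: B) :&: (D :&: setX (W :\: A) A) = set0.
  apply/setP => -[u v]; rewrite !inE; apply/negP.
  case/andP=> /and3P[_ /orP[/eqP->|uA] _] /and3P[_ /andP[nuA uW] _].
    by rewrite (negPf mW) in uW.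
  by rewrite uA in nuA.
rewrite cards0 addn0; apply: eq_card => -[u v]; rewrite !inE /=.
case: ((u, v) \in D) => //=; rewrite ?andbF //.
have := subset_bits v sB; have := subset_bits u sA; have := notin_bits u mW.
by case: (u == m); case: (u \in A); case: (u \in W); case: (v \in B); case: (v \in A).
Qed.

(** E is the disjoint union of E1, the arcs with head in A, and E2, the arcs
    outside the class of m; the other classes depend on E2 only. *)
Lemma class_sum_root :
  class_sum D (m |: W) = \sum_(A : {set V} | A \subset W)
     rooted_weight (1 + q) D m A * arc_weight (1 + q) D (W :\: A) A * e #|A|.+1 * class_sum D (W :\: A).
Proof.
rewrite /class_sum (partition_big (fun E => [set v in W | connect (arc_rel E) m v])
  (fun A => A \subset W)) /=; last first.
  by move=> E _; apply/subsetP => v; rewrite inE => /andP[].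
apply: eq_bigr => A sA.
rewrite (eq_bigl _ _ (fun E => reach_covered E sA)) big_mkcondr /=.
set X1 := D :&: setX U A; set X2 := D :&: setX (W :\: A) (W :\: A).
have dX : [disjoint X1 & X2].
  apply/pred0P => -[u v]; rewrite /= !inE /=; case: (v \in A); rewrite ?andbF //.
rewrite sum_subsetU // -covered_sum // !big_distrl /=; apply: eq_bigr => E1 sE1.
rewrite big_distrr /=; apply: eq_bigr => E2 sE2.
have covU : covered (m |: A) A (E1 :|: E2) = covered (m |: A) A E1.
  apply/forallP/forallP => cov v; apply/implyP => vA;
    have /existsP[u /andP[uP uv]] := implyP (cov v) vA;
    apply/existsP; exists u; rewrite uP; move: uv; rewrite inE; last by move->.
  by case/orP=> // /(subsetP sE2); rewrite !inE vA !andbF.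
rewrite covU; case cov: (covered _ _ _); last by rewrite mulr0 !mul0r.
have dE : [disjoint E1 & E2].
  by apply: disjointWl sE1 _; apply: disjointWr sE2 _.
rewrite mulr1 cardsU (disjoint_setI0 dE) cards0 subn0 exprD -!mulrA; congr (_ * _).
rewrite mulrCA; congr (_ * _).
have /andP[] : (E1 :|: E2 \subset D :&: setX U U)
   && ([set v in W | connect (arc_rel (E1 :|: E2)) m v] == A).
  by rewrite reach_covered // covU cov andbT setUSS.
set E := E1 :|: E2 => sE /eqP reachA.
have rootA v : v \in m |: A -> min_root E v = m.
  move=> vA; apply: min_root_eq.
    case/setU1P: vA => [->|]; first exact: connect0.
    by rewrite -reachA inE => /andP[].
  move=> w /connectP[[|z p] /= pathp lastp].
    by rewrite -lastp; case/setU1P: vA => [->//|/(subsetP sA)/ltm/ltW].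
  case/andP: pathp => /(subsetP sE); rewrite !inE /= => /and3P[_ /orP[/eqP->//|/ltm/ltW->//]].
have backQ : forall u v, (u, v) \in E -> v \in W :\: A -> u \in W :\: A.
  move=> u v; rewrite inE => /orP[/(subsetP sE1)|/(subsetP sE2)]; rewrite !inE.
    by case/and3P=> _ _ ->.
  by case/and3P.
have EQ : E :&: setX (W :\: A) (W :\: A) = E2.
  apply/setP => -[u v]; rewrite !inE /=; have := subset_bits (u, v) sE1; have := subset_bits (u, v) sE2.
  rewrite !inE /=; case: ((u, v) \in E1); case: ((u, v) \in E2);
  case: ((u, v) \in D); case: (u \in W); case: (u \in A);
  case: (v \in A); case: (v \in W); case: (u == m) => //=.
have rootQ v : v \in W :\: A -> min_root E v = min_root E2 v.
  by move=> vQ; rewrite (min_root_back backQ) // EQ.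
rewrite /class_prod.
have defU : m |: W = (m |: A) :|: (W :\: A) by set_tac.
have dU : [disjoint m |: A & W :\: A] by set_tac.
have notQ v : v \in m |: A -> v \notin W :\: A by move=> vA; rewrite (disjointFr dU).
rewrite (big_setID (m |: A)) /=.
have -> : (m |: W) :&: (m |: A) = m |: A by set_tac.
have -> : (m |: W) :\: (m |: A) = W :\: A by set_tac.
rewrite big_setU1 /=; last exact: (notin_sub mW).
rewrite (_ : [set v in m |: W | min_root E v == m] = m |: A); last first.
  apply/setP => v; rewrite inE defU in_setU; case vA: (v \in m |: A) => /=.
    by rewrite rootA ?eqxx.
  apply/negP => /andP[vQ /eqP rm]; have := min_root_in backQ vQ.
  by rewrite rm (negPf (notQ m _)) ?setU11.
rewrite cardsU1 (notin_sub mW) // add1n; congr (_ * _).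
  rewrite big1 ?mulr1 // => u uA.
  rewrite (_ : [set v in _ | _] = set0) ?cards0 ?e0 //; apply/setP => v; rewrite !inE -in_setU1 defU in_setU.
  apply/negP => /andP[/orP[vA|vQ] /eqP ru].
    by move: ru; rewrite rootA // => em; move: uA; rewrite -em; apply/negP; apply: (notin_sub mW).
  by have := min_root_in backQ vQ; rewrite ru inE uA.
apply: eq_bigr => u uQ; congr (e #|pred_of_set _|); apply/setP => v.
rewrite !inE -in_setU1 defU in_setU; case vA: (v \in m |: A) => /=.
  rewrite rootA // -in_setD (negPf (notQ v vA)) /=; apply/eqP => em.
  by have := notQ u; rewrite -em setU11 em uQ => /(_ isT).
by rewrite -in_setD; case vQ: (v \in W :\: A) => //=; rewrite rootQ.
Qed.
End Root.

Lemma class_sum0 D : class_sum D set0 = 1.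
Proof.
rewrite /class_sum (_ : _ :&: _ = set0); last by apply/setP => -[u v]; rewrite !inE !andbF.
by rewrite sum_subset0 cards0 /class_prod big_set0 mulr1.
Qed.
End Classes.

Lemma elem0 (R : comNzRingType) (x : nat -> R) n : elem x n 0 = 1.
Proof. by elim: n => //= n ->; rewrite addr0. Qed.

(** * Colourings and type I edges *)

Section Expansion.
Variables (V : finType) (lab : V -> int).
Hypothesis lab_inj : injective lab.
Implicit Types (S E D : {set V * V}) (W : {set V}).

Section Unicellular.
Variables (R : comNzRingType) (q : R) (x : nat -> R) (N : nat).

Lemma class_sum_colored D W : dyck lab D ->
  class_sum lab q (elem x N) D W = colored (1 + q) D x N W.
Proof.
move=> dyckD; have ltD u v : (u, v) \in D -> lab u < lab v by case/dyckD.
elim/(set_ind_min lab_inj): W => [|m W mW ltm IH].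
  rewrite class_sum0; elim: N => [|n IHn] /=; first by rewrite eqxx.
  by rewrite sum_subset0 setD0 -IHn cards0 wt0l !mulr1.
rewrite (class_sum_root lab_inj) ?elem0 // (colored_rooted lab_inj) //.
apply: eq_bigr => A sA; rewrite IH //; exact: subset_leq_card (subsetDl _ _).
Qed.

(** Colour 0 stands for no colour, so that colourings of W are functions on all
    vertices. *)
Definition supp_on W (k : {ffun V -> 'I_N.+1}) := [forall v, (k v != ord0) == (v \in W)].

Definition descents D (k : {ffun V -> 'I_N.+1}) := [set p in D | (k p.2 < k p.1)%N].

Variable t : R.

Definition strict_color_sum S D W : R :=
  \sum_(k : {ffun V -> 'I_N.+1} | supp_on W k && (descents S k == S))
    t ^+ #|descents D k| * \prod_(v in W) x (k v).

(** Recolouring by 0 the vertices of colour n + 1 reduces n + 1 colours on W to n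
    colours on a subset. *)
Lemma color_sum_bounded D W n : (n <= N)%N ->
  \sum_(k : {ffun V -> 'I_N.+1} | supp_on W k && [forall v, (k v <= n)%N])
    t ^+ #|descents (D :&: setX W W) k| * \prod_(v in W) x (k v)
  = colored t D x n W.
Proof.
elim: n W => [|n IHn] W leN.
  have [->|/set0Pn[v vW]] := eqVneq W set0; last first.
    rewrite /= (negPf (_ : W != set0)) ?big1 //; last by apply/set0Pn; exists v.
    move=> k /andP[/forallP sup /forallP le0]; move: (sup v) (le0 v).
    by rewrite vW leqn0 => /eqP nz; rewrite -(inj_eq val_inj) /= in nz; move/negPf: nz => ->.
  rewrite (big_pred1 [ffun=> ord0]) /= ?eqxx => [|k].
    rewrite big_set0 mulr1 (_ : descents _ _ = set0) ?cards0 //.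
    by apply/setP => -[u v]; rewrite !inE !andbF.
  apply/andP/eqP => [[_ /forallP le0]|->].
    by apply/ffunP => v; apply/val_inj; rewrite ffunE /=; apply/eqP; rewrite -leqn0 le0.
  by split; apply/forallP => v; rewrite ffunE ?inE ?eqxx.
pose top : 'I_N.+1 := inord n.+1.
have topE : top = n.+1 :> nat by rewrite /top inordK.
rewrite /= (partition_big (fun k : {ffun V -> 'I_N.+1} => [set v | k v == top]) (fun A => A \subset W)) /=; last first.
  move=> k /andP[/forallP sup _]; apply/subsetP => v; rewrite inE => /eqP kv.
  by rewrite -(eqP (sup v)) kv -(inj_eq val_inj) /= topE.
apply: eq_bigr => A sA; rewrite -(IHn _ (ltnW leN)) big_distrr /=.
rewrite (reindex_onto (fun k : {ffun V -> 'I_N.+1} => [ffun v => if v \in A then top else k v])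
           (fun k : {ffun V -> 'I_N.+1} => [ffun v => if v \in A then ord0 else k v])) /=; last first.
  move=> k /andP[_ /eqP kA]; apply/ffunP => v; rewrite !ffunE; case vA: (v \in A) => //=.
  by move: vA; rewrite -kA inE => /eqP.
apply: eq_big => [k|k].
  apply/idP/idP.
    case/andP => /andP[/andP[/forallP sup /forallP le] /eqP eA] /eqP ek.
    have k0 v : v \in A -> k v = ord0 by move=> vA; rewrite -ek !ffunE vA.
    apply/andP; split; apply/forallP => v.
      rewrite inE; have := sup v; rewrite ffunE; case: ifP => [vA _|vA /eqP <-] //=.
      by rewrite k0 ?eqxx.
    have := le v; rewrite ffunE; case: ifP => [vA _|vA]; first by rewrite k0.
    rewrite leq_eqVlt => /orP[/eqP kv|//].
    have : v \in [set v | [ffun v => if v \in A then top else k v] v == top].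
      by rewrite inE ffunE vA -(inj_eq val_inj) /= topE kv.
    by rewrite eA vA.
  case/andP=> /forallP sup /forallP le.
  have kA v : v \in A -> k v = ord0.
    by move=> vA; apply/eqP; rewrite -[_ == _]negbK (eqP (sup v)) inE vA.
  apply/andP; split; last first.
    by apply/eqP/ffunP => v; rewrite !ffunE; case vA: (v \in A) => //=; rewrite kA.
  apply/andP; split.
    apply/andP; split; apply/forallP => v; rewrite ffunE; case: ifP => vA.
    - by rewrite (subsetP sA) // eqb_id -(inj_eq val_inj) /= topE.
    - by have := sup v; rewrite inE vA.
    - by rewrite topE.
    - by apply: leqW.
  apply/eqP/setP => v; rewrite inE ffunE; case: ifP => vA; first by rewrite eqxx.
  by apply/negP => /eqP kv; have := le v; rewrite kv topE ltnn.
case/andP=> /andP[/andP[_ /forallP le] /eqP eA] /eqP ek.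
set k' := [ffun v => _] in le eA ek *.
have kA v : v \in A -> k v = ord0 by move=> vA; rewrite -ek !ffunE vA.
have k'A v : v \in A -> k' v = top by move=> vA; rewrite ffunE vA.
have k'N v : v \notin A -> k' v = k v by move=> vA; rewrite ffunE (negPf vA).
have lt_top v : v \notin A -> (k v < n.+1)%N.
  move=> vA; have := le v; rewrite k'N // leq_eqVlt => /orP[/eqP kv|//].
  have : v \in [set v | k' v == top] by rewrite inE k'N // -(inj_eq val_inj) /= topE kv.
  by rewrite eA (negPf vA).
have -> : \prod_(v in W) x (k' v) = x n.+1 ^+ #|A| * \prod_(v in W :\: A) x (k v).
  rewrite (big_setID A) /= (setIidPr sA) -prodr_const; congr (_ * _); apply: eq_bigr => v.
    by move=> vA; rewrite k'A // topE.
  by case/setDP => _ vA; rewrite k'N.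
rewrite mulrACA mulrA [t ^+ _ * _]mulrC -!mulrA; congr (_ * _); rewrite !mulrA; congr (_ * _).
rewrite /arc_weight -exprD -cardsUI; congr (t ^+ _).
rewrite [X in (_ + X)%N](_ : _ = 0%N) ?addn0; last first.
  apply/eqP; rewrite cards_eq0; apply/eqP/setP => -[u v]; rewrite !inE /=.
  by case: (u \in A); rewrite ?andbF.
apply: eq_card => -[u v]; rewrite !inE /=.
case: ((u, v) \in D) => //=; case uA: (u \in A) => /=; case vA: (v \in A) => /=.
- by rewrite (k'A u) // (k'A v) // ltnn !andbF.
- by rewrite (k'A u) // (k'N v) ?vA // topE lt_top ?vA // (subsetP sA u uA) ?andbT ?orbF.
- by rewrite (k'A v) // (k'N u) ?uA // topE ltnNge ltnW ?lt_top ?uA // !andbF.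
- by rewrite (k'N u) ?uA // (k'N v) ?vA // orbF.
Qed.

Lemma strict_color_sum0 D W : strict_color_sum set0 (D :&: setX W W) W = colored t D x N W.
Proof.
rewrite -(color_sum_bounded D W (leqnn N)) /strict_color_sum; apply: eq_bigl => k; congr (_ && _).
rewrite (_ : descents _ _ = set0) ?eqxx; last by apply/setP => p; rewrite !inE.
by symmetry; apply/forallP => v; rewrite -ltnS ltn_ord.
Qed.
End Unicellular.

Section Strict.
Variables (R : idomainType) (q : R) (x : nat -> R) (N : nat).
Hypothesis q_neq0 : q != 0.

Definition strict_class_sum S D W : R :=
  \sum_(E : {set V * V} | E \subset D) q ^+ #|E| * class_prod lab (elem x N) (S :|: E) W.

(** In the sum for c |: D, the sets E without c give the sum for D, and those
    with c give q times the sum in which c is forced. *)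
Lemma strict_class_sumU1 c S D W : c \notin D ->
  strict_class_sum S (c |: D) W = strict_class_sum S D W + q * strict_class_sum (c |: S) D W.
Proof.
move=> cD; rewrite /strict_class_sum sum_subsetU1 //; congr (_ + _).
rewrite big_distrr /=; apply: eq_bigr => E sE.
rewrite cardsU1 (notin_sub cD) // add1n exprS -mulrA; do 2!congr (_ * _).
by rewrite setUCA setUA.
Qed.

(** An arc c contributes t = 1 + q to a colouring that decreases along c, and 1
    to any other. *)
Lemma strict_color_sumU1 c S D W : c \notin D -> c \notin S ->
  strict_color_sum x N (1 + q) S (c |: D) W
  = strict_color_sum x N (1 + q) S D W + q * strict_color_sum x N (1 + q) (c |: S) D W.
Proof.
move=> cD cS; rewrite /strict_color_sum.
have desU1 X k : descents (N := N) (c |: X) k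
    = if (k c.2 < k c.1)%N then c |: descents X k else descents X k.
  apply/setP => p; case: ifP => kc; rewrite !inE; case: eqP => [->|] //=.
    by rewrite kc andbF.
rewrite big_distrr /= [X in _ = _ + X](eq_bigl
   (fun k => (supp_on W k && (descents S k == S)) && (k c.2 < k c.1)%N)); last first.
  move=> k; rewrite -andbA; congr (_ && _); rewrite desU1; case: ifP => kc.
    rewrite andbT; apply/eqP/eqP => [eS|-> //].
    have cdS : c \notin descents S k by rewrite inE (negPf cS).
    by rewrite -(setU1K cdS) eS setU1K.
  rewrite andbF; apply/negP => /eqP eS; have : c \in c |: S by rewrite setU11.
  by rewrite -eS inE (negPf cS).
rewrite [X in _ = _ + X]big_mkcondr -big_split /=; apply: eq_bigr => k _.
rewrite desU1; case: ifP => kc; last by rewrite addr0.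
by rewrite cardsU1 inE (negPf cD) add1n exprS; ring.
Qed.

(** The strict arcs are removed one by one, by means of the two lemmas above;
    dividing by q is what requires an integral domain.  The hypothesis on S' says
    that any of the strict arcs can be made double. *)
Lemma strict_color_class_sum S D W : [disjoint S & D] ->
  (forall S', S' \subset S -> exists2 D', dyck lab D' & D :|: S' = D' :&: setX W W) ->
  strict_color_sum x N (1 + q) S D W = strict_class_sum S D W.
Proof.
elim: {S}_.+1 {-2}S D (ltnSn #|S|) => // n IHn S D leS dSD dyckSD.
have [S0|/set0Pn[c cS]] := eqVneq S set0.
  have [D' dyckD' eD] := dyckSD set0 (sub0set _).
  rewrite S0 -[D]setU0 eD strict_color_sum0 -class_sum_colored // /strict_class_sum /class_sum.
  by apply: eq_bigr => E _; rewrite set0U.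
have cD : c \notin D by rewrite (disjointFr dSD).
move: leS dSD dyckSD; rewrite -(setD1K cS); set S1 := S :\ c.
have cS1 : c \notin S1 by rewrite setD11.
rewrite cardsU1 cS1 add1n => leS dSD dyckSD.
have dS1D : [disjoint S1 & D] by apply: disjointWl dSD; apply: subsetUr.
apply: (mulfI q_neq0); apply: (addrI (strict_class_sum S1 D W)).
rewrite -strict_class_sumU1 // -[in LHS](IHn S1 D) //; last first.
  by move=> S' sS'; apply: dyckSD; apply: subset_trans sS' (subsetUr _ _).
rewrite -strict_color_sumU1 // IHn //.
  by clearbody S1; set_tac.
move=> S' sS'; have [|D' dyckD' eD] := dyckSD (c |: S'); first exact: setUS.
by exists D' => //; rewrite -eD setUCA setUA.
Qed.
End Strict.
End Expansion.

(** * Products over blocks *)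

Section Blocks.
Variables (V : finType) (lab : V -> int).
Hypothesis lab_inj : injective lab.
Variables (R : comNzRingType) (e : nat -> R).
Implicit Types (G S E D : {set V * V}) (W : {set V}).

Lemma class_prod_union G1 G2 W1 W2 : [disjoint W1 & W2] ->
  G1 \subset setX W1 W1 -> G2 \subset setX W2 W2 ->
  class_prod lab e (G1 :|: G2) (W1 :|: W2)
  = class_prod lab e G1 W1 * class_prod lab e G2 W2.
Proof.
move=> dW sG1 sG2.
have half (Ga Gb : {set V * V}) (Wa Wb : {set V}) : [disjoint Wa & Wb] -> Ga \subset setX Wa Wa -> Gb \subset setX Wb Wb ->
    (forall v, v \in Wa -> min_root lab (Ga :|: Gb) v = min_root lab Ga v)
    /\ (forall v, v \in Wa -> min_root lab (Ga :|: Gb) v \in Wa).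
  move=> dab sa sb.
  have back : forall u v, (u, v) \in Ga :|: Gb -> v \in Wa -> u \in Wa.
    move=> u v; rewrite inE => /orP[/(subsetP sa)|/(subsetP sb)]; rewrite inE => /andP[] // _.
    by move=> vb va; rewrite (disjointFr dab va) in vb.
  split=> v va; last exact: (min_root_in lab back va).
  rewrite (min_root_back lab_inj back va); congr (min_root _ _ _).
  apply/setP => -[a b]; rewrite !inE /=; apply/idP/idP => [|abG].
    case/andP => /orP[//|/(subsetP sb)]; rewrite inE /= => /andP[ab _] /andP[aa _].
    by rewrite (disjointFr dab aa) in ab.
  by rewrite abG; have := subsetP sa _ abG; rewrite inE.
have [r1 i1] := half _ _ _ _ dW sG1 sG2.
have [r2 i2] : (forall v, v \in W2 -> min_root lab (G1 :|: G2) v = min_root lab G2 v)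
    /\ (forall v, v \in W2 -> min_root lab (G1 :|: G2) v \in W2).
  by rewrite setUC; apply: (half G2 G1 W2 W1) => //; rewrite disjoint_sym.
rewrite /class_prod (big_setID W1) /=.
have -> : (W1 :|: W2) :&: W1 = W1 by set_tac.
have -> : (W1 :|: W2) :\: W1 = W2 by set_tac.
congr (_ * _); apply: eq_bigr => u uW; congr (e #|pred_of_set _|); apply/setP => v; rewrite !inE.
  case v1: (v \in W1) => /=; first by rewrite r1.
  apply/negP => /andP[v2 /eqP ru]; have := i2 v v2; rewrite ru.
  by rewrite (disjointFr dW uW).
case v2: (v \in W2); rewrite ?orbT ?orbF /=; first by rewrite r2.
apply/negP => /andP[v1 /eqP ru]; have := i1 v v1; rewrite ru.
by rewrite (disjointFl dW uW).
Qed.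
End Blocks.

Section ClassSumBlocks.
Variables (V : finType) (lab : V -> int).
Hypothesis lab_inj : injective lab.
Variables (R : idomainType) (q : R) (x : nat -> R) (N : nat).
Local Notation class_sumN := (strict_class_sum lab q x N).
Implicit Types (G S E D : {set V * V}) (W : {set V}).

Lemma strict_class_sumU S1 S2 D1 D2 W1 W2 : [disjoint W1 & W2] ->
  S1 \subset setX W1 W1 -> S2 \subset setX W2 W2 ->
  D1 \subset setX W1 W1 -> D2 \subset setX W2 W2 ->
  class_sumN (S1 :|: S2) (D1 :|: D2) (W1 :|: W2)
  = class_sumN S1 D1 W1 * class_sumN S2 D2 W2.
Proof.
move=> dW sS1 sS2 sD1 sD2.
have dD : [disjoint D1 & D2].
  apply/pred0P => -[u v] /=; apply/negP => /andP[/(subsetP sD1) + /(subsetP sD2)].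
  by rewrite !inE => /andP[u1 _] /andP[u2 _]; rewrite (disjointFr dW u1) in u2.
rewrite /strict_class_sum sum_subsetU // big_distrl /=; apply: eq_bigr => E1 sE1.
rewrite big_distrr /=; apply: eq_bigr => E2 sE2.
have -> : S1 :|: S2 :|: (E1 :|: E2) = (S1 :|: E1) :|: (S2 :|: E2).
  by rewrite setUACA.
rewrite (class_prod_union lab_inj) //.
- have dE : [disjoint E1 & E2] by apply: disjointWl sE1 _; apply: disjointWr sE2 _.
  by rewrite cardsU (disjoint_setI0 dE) cards0 subn0 exprD; ring.
- by rewrite subUset sS1 (subset_trans sE1).
- by rewrite subUset sS2 (subset_trans sE2).
Qed.

Lemma strict_class_sum0 S D : class_sumN (S :&: setX set0 set0) (D :&: setX set0 set0) set0 = 1.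
Proof.
have e0 X : X :&: setX set0 set0 = set0 :> {set V * V}.
  by apply/setP => -[u v]; rewrite !inE !andbF.
by rewrite /strict_class_sum !e0 sum_subset0 cards0 /class_prod big_set0 mulr1.
Qed.

(** Deleting the double arcs between different fibres of c makes the sum
    multiplicative over the fibres. *)
Lemma strict_class_sum_blocks (T : finType) (c : V -> T) S D (X : {set T}) :
  (forall p, p \in S -> c p.1 = c p.2) ->
  \prod_(B in X) class_sumN (S :&: setX (c @^-1: [set B]) (c @^-1: [set B]))
     (D :&: setX (c @^-1: [set B]) (c @^-1: [set B])) (c @^-1: [set B])
  = class_sumN (S :&: setX (c @^-1: X) (c @^-1: X))
     ([set p in D | c p.1 == c p.2] :&: setX (c @^-1: X) (c @^-1: X)) (c @^-1: X).
Proof.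
(* Only the rule for disjoint unions and the value on the empty set matter. *)
have fU := strict_class_sumU; have f0 := strict_class_sum0.
move: (strict_class_sum _ _ _ _) fU f0 => F fU f0.
move=> cS; elim: {X}_.+1 {-2}X (ltnSn #|X|) => // n IHn X leX.
have [->|[B BX]] := set_0Vmem X; first by rewrite big_set0 preimset0 f0.
rewrite (big_setD1 B) //= IHn; last by rewrite (cardsD1 B) BX in leX.
rewrite -fU ?subsetIr //; last first.
  apply/pred0P => v /=; rewrite !inE; by case: eqP => // ->; rewrite eqxx.
have -> : c @^-1: [set B] :|: c @^-1: (X :\ B) = c @^-1: X by rewrite -preimsetU setD1K.
congr (F _ _ _); apply/setP => -[u v]; rewrite !inE /=.
  have := cS (u, v); case: ((u, v) \in S) => //= /(_ isT) ->.
  by case: eqP => [->|] //=; rewrite ?BX ?andbb.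
case: ((u, v) \in D) => //=; case: (c u =P c v) => [->|nuv] /=.
  by case: eqP => [->|] //=; rewrite ?BX ?andbb ?orbF.
by rewrite orbF; apply/negP => /andP[/eqP eu /eqP ev]; apply: nuv; rewrite eu ev.
Qed.
End ClassSumBlocks.

(** * The cumulant coefficients of stable partitions *)

Section PartitionSum.
Variables (T : finType) (e : rel T) (x0 : T) (K : comNzRingType).
Hypothesis e_sym : ssrbool.symmetric e.
Implicit Types (P : {set {set T}}) (B C : {set T}).

Definition stable B := [forall i, forall j, e i j ==> ((i \in B) == (j \in B))].
Definition stable_partition P := partition P [set: T] && [forall B in P, stable B].
Definition cumulant_coef (k : nat) : K := (-1) ^+ k.-1 * (k.-1)`!%:R.

Definition component := [set j | connect e x0 j].

Lemma stableP B : reflect (forall i j, e i j -> (i \in B) = (j \in B)) (stable B).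
Proof.
apply: (iffP forallP) => [st i j eij|st i]; last by apply/forallP => j; apply/implyP => /st ->.
by have /forallP/(_ j) := st i; rewrite eij => /eqP.
Qed.

Lemma stable_component : stable component.
Proof.
apply/stableP => i j eij; rewrite !inE; apply/idP/idP => c0.
  by apply: connect_trans c0 (connect1 eij).
by apply: connect_trans c0 (connect1 _); rewrite e_sym.
Qed.

Lemma stableU B C : stable B -> stable C -> stable (B :|: C).
Proof.
by move=> /stableP sB /stableP sC; apply/stableP => i j eij; rewrite !inE (sB i j) // (sC i j).
Qed.

Lemma stableD B C : stable B -> stable C -> stable (B :\: C).
Proof.
by move=> /stableP sB /stableP sC; apply/stableP => i j eij; rewrite !inE (sB i j) // (sC i j).
Qed.

Lemma stable_sub B : stable B -> x0 \in B -> component \subset B.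
Proof.
move=> /stableP sB xB; apply/subsetP => j; rewrite inE => /connectP[p].
elim: p x0 xB => [|y p IHp] z zB /=; first by move=> _ ->.
by case/andP => ezy pp ej; apply: (IHp y) => //; rewrite -(sB z).
Qed.

Lemma pblock_sub P : stable_partition P -> component \subset pblock P x0 /\ pblock P x0 \in P.
Proof.
case/andP => partP /forall_inP stP.
have xP : x0 \in cover P by rewrite (cover_partition partP) inE.
have bP := pblock_mem xP; split=> //.
by apply: stable_sub; [apply: stP|rewrite mem_pblock].
Qed.

Lemma x0C : x0 \in component. Proof. by rewrite inE connect0. Qed.
Lemma component_neq0 : component != set0. Proof. by apply/set0Pn; exists x0; apply: x0C. Qed.

(** The two inverse operations that pair stable partitions without the block
    [component] to stable partitions that have it, with a second block B. *)
Definition split_block P := component |: ((pblock P x0 :\: component) |: (P :\ pblock P x0)).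
Definition merge_block P B := (component :|: B) |: (P :\ component :\ B).

Lemma stable_partition_disjoint P B C : stable_partition P -> B \in P -> C \in P ->
  B != C -> [disjoint B & C].
Proof. by case/andP => /partition_trivIset /trivIsetP tI _; apply: tI. Qed.

Lemma merge_stable P B : stable_partition P -> component \in P -> B \in P :\ component ->
  stable_partition (merge_block P B) /\ component \notin merge_block P B.
Proof.
move=> sp CP /setD1P[BC BP]; have dBC := stable_partition_disjoint sp BP CP BC.
have /andP[partP /forall_inP stP] := sp.
have BP' : B \in P :\ component by rewrite !inE BC.
have B0 : B != set0 by apply: contraTneq BP => ->; rewrite (partition0 partP).
split; last first.
  rewrite !inE eqxx andbF orbF; apply: contraNneq B0 => eC.
  by rewrite -subset0 -(disjoint_setI0 dBC) subsetI subxx eC subsetUr.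
apply/andP; split.
  have := partitionD1 (partitionD1 partP CP) BP'.
  move/(partitionU1 (B := component :|: B)); rewrite -/(merge_block P B).
  have -> : component :|: B :|: [set: T] :\: component :\: B = [set: T].
    by apply/setP => v; rewrite !inE andbT; case: connect; case: (v \in B).
  apply; last by apply/pred0P => v /=; rewrite !inE; case: connect; case: (v \in B).
  by apply/set0Pn; exists x0; rewrite inE x0C.
apply/forall_inP => D; rewrite !inE => /orP[/eqP->|/and3P[_ _ /stP //]].
by apply: stableU; [apply: stable_component|apply: stP].
Qed.

Lemma split_stable P : stable_partition P -> component \notin P ->
  [/\ stable_partition (split_block P), component \in split_block P,
      pblock P x0 :\: component \in split_block P :\ component
    & merge_block (split_block P) (pblock P x0 :\: component) = P].
Proof.
move=> sp CP; have [sub bP] := pblock_sub sp; set B0 := pblock P x0 in sub bP *.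
have /andP[partP /forall_inP stP] := sp.
have nsub : B0 :\: component != set0.
  rewrite setD_eq0; apply: contra CP => sub'.
  by rewrite (_ : component = B0) //; apply/eqP; rewrite eqEsubset sub.
have nCP D : D \in P -> D != component by apply: contraTneq => ->.
have nBP D : D \in P :\ B0 -> D != B0 :\: component.
  case/setD1P => DB DP; have dD := stable_partition_disjoint sp DP bP DB.
  apply: contraNneq nsub => eD; rewrite -subset0 -(disjoint_setI0 dD) subsetI -eD subxx /=.
  by rewrite eD subsetDl.
split.
- apply/andP; split.
    have p1 := partitionD1 partP bP.
    have p2 := partitionU1 p1 nsub.
    have := partitionU1 (p2 _) component_neq0; rewrite -/B0.
    have -> : component :|: (B0 :\: component :|: [set: T] :\: B0) = [set: T].
      apply/setP => v; have := subset_bits v sub; rewrite !inE andbT.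
      by case: connect; case: (v \in B0).
    apply; last by apply/pred0P => v; have := subset_bits v sub; rewrite /= !inE andbT; case: connect; case: (v \in B0).
    by apply/pred0P => v; rewrite /= !inE andbT; case: connect; case: (v \in B0).
  apply/forall_inP => D; rewrite !inE => /or3P[/eqP->|/eqP->|/andP[_ /stP //]].
    exact: stable_component.
  by apply: stableD; [apply: stP|apply: stable_component].
- by rewrite setU11.
- rewrite !inE eqxx orbT andbT; apply: contraNneq component_neq0 => eC.
  rewrite -subset0; apply/subsetP => v vC.
  by move: (vC); rewrite -{1}eC => /setDP[_]; rewrite vC.
rewrite /merge_block /split_block.
have -> : component :|: (B0 :\: component) = B0.
  apply/setP => v; have := subset_bits v sub; rewrite !inE.
  by case: connect; case: (v \in B0).
rewrite setU1K; last first.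
  rewrite !inE negb_or; apply/andP; split; last by apply/negP => /andP[_ /nCP /eqP].
  apply: contraNneq component_neq0 => eC; rewrite -subset0; apply/subsetP => v vC.
  by move: (vC); rewrite {1}eC => /setDP[_]; rewrite vC.
rewrite setU1K; last by apply/negP => /nBP /eqP.
by rewrite setD1K.
Qed.

Lemma merge_fresh P B : stable_partition P -> component \in P ->
  component :|: B \notin P :\ component :\ B.
Proof.
move=> sp CP; apply/negP => /setD1P[_ /setD1P[nC UP]].
have dUC := stable_partition_disjoint sp UP CP nC.
by have := disjoint_bits x0 dUC; rewrite inE x0C.
Qed.

Lemma split_merge P B : stable_partition P -> component \in P -> B \in P :\ component ->
  split_block (merge_block P B) = P /\ pblock (merge_block P B) x0 :\: component = B.
Proof.
move=> sp CP BP'; have [sm _] := merge_stable sp CP BP'.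
case/setD1P: (BP') => BC BP; have dBC := stable_partition_disjoint sp BP CP BC.
have ePb : pblock (merge_block P B) x0 = component :|: B.
  case/andP: sm => /partition_trivIset tI _.
  by apply: def_pblock tI _ _; rewrite ?setU11 // inE x0C.
rewrite /split_block ePb.
have -> : (component :|: B) :\: component = B.
  apply/setP => v; have := disjoint_bits v dBC; rewrite !inE.
  by case: connect; case: (v \in B).
by rewrite /merge_block setU1K ?setD1K // merge_fresh.
Qed.

Lemma card_merge P B : stable_partition P -> component \in P -> B \in P :\ component ->
  #|merge_block P B| = #|P|.-1.
Proof.
move=> sp CP BP; rewrite /merge_block cardsU1 merge_fresh // add1n.
by rewrite (cardsD1 component P) CP (cardsD1 B (P :\ component)) BP.
Qed.

(** With k = #|P|, the partition P itself contributes (-1) ^ (k - 1) (k - 1)!, and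
    each of its k - 1 mergers contributes (-1) ^ (k - 2) (k - 2)!. *)
Lemma cumulant_coef_sum P : stable_partition P -> component \in P -> component != [set: T] ->
  cumulant_coef #|P| + \sum_(B in P :\ component) cumulant_coef #|P|.-1 = 0.
Proof.
move=> /andP[partP _] CP CT; rewrite sumr_const.
have : (0 < #|P :\ component|)%N.
  rewrite card_gt0; apply: contra CT => /eqP P0.
  have := cover_partition partP; rewrite -(setD1K CP) P0 setU0 /cover big_set1 => ->.
  exact: eqxx.
rewrite (cardsD1 component P) CP add1n /=; case: #|_| => // k _.
rewrite /cumulant_coef /= factS exprS natrM -[X in _ + X]mulr_natr; ring.
Qed.

(** Unless e is connected, the component C of x0 is a proper subset.  Group the
    stable partitions with C as a block together with those obtained from them
    by merging C with another block: each group sums to zero. *)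
Lemma stable_partition_sum :
  \sum_(P : {set {set T}} | stable_partition P) cumulant_coef #|P|
  = [forall i, forall j, connect e i j]%:R.
Proof.
have csym : connect_sym e by apply: sym_connect_sym.
have -> : [forall i, forall j, connect e i j] = (component == [set: T]).
  apply/forallP/eqP => [conn|CT i].
    by apply/setP => j; rewrite !inE; apply: (forallP (conn x0)).
  apply/forallP => j; have : i \in component by rewrite CT inE.
  have : j \in component by rewrite CT inE.
  by rewrite !inE => xj xi; apply: connect_trans xj; rewrite csym.
have [CT|CT] := eqVneq component [set: T].
  rewrite (big_pred1 [set [set: T]]) => [|P]; first by rewrite cards1 /cumulant_coef /= mulr1.
  apply/idP/eqP => [sp|->].
    have [sub bP] := pblock_sub sp; have /andP[partP _] := sp.
    move: sub; rewrite CT subTset => /eqP eB; rewrite eB in bP.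
    apply/setP => B; rewrite inE; apply/idP/eqP => [BP|-> //].
    apply/eqP; apply: contraT => nB.
    have := stable_partition_disjoint sp BP bP nB; rewrite -setI_eq0 setIT => /eqP B0.
    by move: BP; rewrite B0 (partition0 partP).
  apply/andP; split; last first.
    by apply/forall_inP => B /set1P->; apply/stableP => i j _; rewrite !inE.
  rewrite /partition /cover /trivIset !big_set1 !eqxx /= inE eq_sym -CT.
  by rewrite /cover big_set1 eqxx eq_sym component_neq0.
rewrite (bigID (fun P : {set {set T}} => component \in P)) /=.
have -> : \sum_(P : {set {set T}} | stable_partition P && (component \notin P)) cumulant_coef #|P|
  = \sum_(P : {set {set T}} | stable_partition P && (component \in P))
      \sum_(B in P :\ component) cumulant_coef #|P|.-1.
  rewrite pair_big_dep /=.
  rewrite [RHS](reindex_onto (fun P => (split_block P, pblock P x0 :\: component))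
     (fun p => merge_block p.1 p.2)) /=; last first.
    move=> [P B] /andP[/andP[sp CP] BP] /=.
    by have [-> ->] := split_merge sp CP BP.
  apply: eq_big => [P|P /andP[sp nC]].
    apply/idP/idP => [/andP[sp nC]|].
      by have [-> -> -> ->] := split_stable sp nC; rewrite eqxx.
    case/andP=> /andP[/andP[sp CP] BP] /eqP <-.
    by have [-> ->] := merge_stable sp CP BP.
  have [ss Cs Bs eP] := split_stable sp nC.
  by rewrite -{1}eP card_merge.
rewrite -big_split big1 //= => P /andP[sp CP]; exact: cumulant_coef_sum.
Qed.
End PartitionSum.

(** * The LLT graph of vertical strips *)

Section Geometry.
Variables (l : nat) (nu : 'I_l -> vstrip).
Implicit Types b c : box nu.

(** Attacks depend only on the contents and the relative order of the strips,
    not on their number: this makes them compatible with [restrict]. *)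
Lemma attacksE b c : attacks b c =
  ((content c == content b) && (tag b < tag c)%N)
  || ((content c == content b + 1) && (tag c < tag b)%N).
Proof.
rewrite /attacks /shifted_content.
have := ltn_ord (tag b); have := ltn_ord (tag c).
move: (content b) (content c) (nat_of_ord (tag b)) (nat_of_ord (tag c)) => x y i j.
move=> ltj lti.
have [e|[e|[e|e]]] : y <= x - 1 \/ y = x \/ y = x + 1 \/ y >= x + 2 by lia.
- have : l%:Z * (y - x) <= - l%:Z by nia.
  rewrite mulrBr; lia.
- rewrite e; lia.
- rewrite e mulrDr mulr1; lia.
- have : l%:Z * (y - x) >= 2 * l%:Z by nia.
  rewrite mulrBr; lia.
Qed.

Lemma label_inj : injective (@shifted_content l nu).
Proof.
move=> b c; rewrite /shifted_content => e.
have [ec et] : content b = content c /\ (tag b : nat) = tag c.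
  move: e; have := ltn_ord (tag b); have := ltn_ord (tag c).
  move: (content b) (content c) (nat_of_ord (tag b)) (nat_of_ord (tag c)) => x y i j ltj lti.
  have [e|[e|e]] : y <= x - 1 \/ y = x \/ y >= x + 1 by lia.
  - have : l%:Z * (x - y) >= l%:Z by nia.
    rewrite mulrBr; lia.
  - rewrite e; lia.
  - have : l%:Z * (y - x) >= l%:Z by nia.
    rewrite mulrBr; lia.
case: b c ec et {e} => i j [i' j'] /= ec et.
have ei : i = i' by apply: val_inj.
subst i'; congr (Tagged _ _); apply: val_inj.
move: ec; rewrite /content /box_row /box_col /=; lia.
Qed.

Lemma typeI_label b c : typeI_edge b c -> shifted_content c = shifted_content b + l%:Z.
Proof.
case/andP => /eqP et /eqP er; rewrite /shifted_content /content /box_col et er; lia.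
Qed.

Definition column_edges : {set box nu * box nu} := [set p | typeI_edge p.1 p.2].

(** Double edges join labels at distance less than l, and type I edges join
    labels at distance l; strictly between the ends of an arc, all pairs of
    labels are at distance less than l. *)
Lemma dyck_edges (S : {set box nu * box nu}) : S \subset column_edges ->
  dyck (@shifted_content l nu) (double_edges nu :|: S).
Proof.
move=> /subsetP sS u w; rewrite !inE /= => uw.
have ltl : (0 < l)%N by apply: leq_ltn_trans (ltn_ord (tag u)).
have : (attacks u w \/ ((u, w) \in S /\ shifted_content w = shifted_content u + l%:Z)).
  by case/orP: uw => [|uS]; [left|right; split=> //; apply: typeI_label; have := sS _ uS; rewrite inE].
rewrite {1}/attacks => H; split; first by lia.
move=> u' w' le1 lt le2; rewrite !inE /= /attacks.
have -> : 0 < shifted_content w' - shifted_content u' by lia.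
case: ltP => //= ge2.
have [uS ew] : (u, w) \in S /\ shifted_content w = shifted_content u + l%:Z by case: H => // H; lia.
have -> : u' = u by apply: label_inj; lia.
have -> : w' = w by apply: label_inj; lia.
by rewrite uS.
Qed.

Lemma columns_double_disjoint : [disjoint column_edges & double_edges nu].
Proof.
apply/pred0P => -[b c] /=; rewrite !inE /= /attacks; apply/negP => /andP[/typeI_label ->]; lia.
Qed.
End Geometry.

Section Lambda.
Variables (l : nat) (nu : 'I_l -> vstrip) (E : {set box nu * box nu}).
Hypothesis sE : E \subset double_edges nu.
Local Notation lab := (@shifted_content l nu).

Lemma edgeE : edge E =2 arc_rel (column_edges nu :|: E).
Proof. by move=> b c; rewrite /edge /arc_rel !inE. Qed.

Lemma thetaE v : theta E v = Some (min_root lab (column_edges nu :|: E) v).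
Proof.
have connE := eq_connect edgeE.
set G := column_edges nu :|: E in connE *.
have [cr min_r] := min_rootP lab G v.
have lt_arc b c : arc_rel G b c -> lab b < lab c.
  move=> bc; have := dyck_edges (subxx (column_edges nu)).
  case/(_ b c) => //; move: bc; rewrite /arc_rel /G setUC; apply: subsetP; exact: setSU.
have src : source E (min_root lab G v).
  apply/forallP => c; apply/negP => cr'; rewrite edgeE in cr'.
  have := min_r c (connect_trans (connect1 cr') cr).
  by rewrite leNgt lt_arc.
rewrite /theta; case: pickP => [u /and3P[su cu /forallP min_u]|none].
  congr Some; apply: (@label_inj _ nu); apply/eqP; rewrite eq_le.
  rewrite min_r ?andbT; last by rewrite -connE.
  by have := min_u (min_root lab G v); rewrite src connE cr.
have := none (min_root lab G v); rewrite src connE cr /=.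
case/negP; apply/forallP => w; apply/implyP => /andP[_]; rewrite connE; exact: min_r.
Qed.

Lemma mesym_part_lambda (N : nat) (K : fieldType) :
  mesym_part N K (lambda E) = class_prod lab (mesym N K) (column_edges nu :|: E) [set: box nu].
Proof.
set G := column_edges nu :|: E.
rewrite /mesym_part /lambda (perm_big _ (permEl (perm_sort _ _))) /= big_map big_enum /=.
pose cls u := [set v | min_root lab G v == u].
pose Rt := [set min_root lab G v | v : box nu].
have -> : preim_partition (theta E) [set: box nu] = cls @: Rt.
  apply/setP => C; apply/imsetP/imsetP => [[v _ ->]|[u /imsetP[v _ ->] ->]].
    exists (min_root lab G v); first exact: imset_f.
    by apply/setP => w; rewrite !inE !thetaE; apply/eqP/eqP => [[->]|->].
  exists v; rewrite ?inE //.
  by apply/setP => w; rewrite !inE !thetaE; apply/eqP/eqP => [->|[->]].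
rewrite big_imset /=; last first.
  move=> u u' /imsetP[v _ ->] _ /setP/(_ v); rewrite !inE eqxx => /esym /eqP; exact.
rewrite /class_prod [RHS](bigID (mem Rt)) /= [X in _ * X]big1 ?mulr1 => [|u /andP[_ uR]].
  apply: eq_big => u; first by rewrite inE.
  by move=> _; congr (mesym _ _ #|pred_of_set _|); apply/setP => v; rewrite !inE.
rewrite (_ : [set v in _ | _] = set0) ?cards0 ?mesym0E //.
apply/setP => v; rewrite !inE; apply: contraNF uR => /eqP <-; exact: imset_f.
Qed.
End Lambda.

Section Elem.
Variables (N : nat) (K : fieldType).

(** Colours start from 1, while the variables start from 0. *)
Definition shifted_var (k : nat) : {mpoly K[N]} :=
  if k is k'.+1 then (if insub k' is Some i then 'X_i else 0) else 0.

Lemma shifted_var_lift (i : 'I_N) : shifted_var (lift ord0 i) = 'X_i.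
Proof. by rewrite lift0 /= valK. Qed.

Lemma elem_bounded n k : (n <= N)%N ->
  elem shifted_var n k = \sum_(h : {set 'I_N} | (#|h| == k) && (h \subset [set i : 'I_N | (i < n)%N]))
     \prod_(i in h) 'X_i.
Proof.
elim: n k => [|n IHn] k leN.
  have -> : [set i : 'I_N | (i < 0)%N] = set0 by apply/setP => i; rewrite !inE.
  rewrite (eq_bigl (fun h : {set 'I_N} => (h \subset set0) && (#|h| == k))); last by move=> h; rewrite andbC.
  rewrite big_mkcondr sum_subset0 cards0 big_set0 /= eq_sym; by case: eqP.
pose o := Ordinal leN.
have -> : [set i : 'I_N | (i < n.+1)%N] = o |: [set i : 'I_N | (i < n)%N].
  by apply/setP => i; rewrite !inE ltnS leq_eqVlt -(inj_eq val_inj).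
have oN : o \notin [set i : 'I_N | (i < n)%N] by rewrite inE ltnn.
rewrite (eq_bigl (fun h : {set 'I_N} => (h \subset o |: [set i : 'I_N | (i < n)%N]) && (#|h| == k))); last by move=> h; rewrite andbC.
rewrite big_mkcondr sum_subsetU1 // -!big_mkcondr /= IHn ?(ltnW leN) //; congr (_ + _).
  by apply: eq_bigl => h; rewrite andbC.
case: k => [|k].
  by rewrite big1 // => h; rewrite cardsU1; case/andP => /(notin_sub oN)->.
rewrite IHn ?(ltnW leN) // big_distrr /=; apply: eq_big => h.
  by rewrite andbC; case sh: (_ \subset _) => //=; rewrite cardsU1 (notin_sub oN sh) add1n.
case/andP => _ sh; rewrite big_setU1 ?(notin_sub oN sh) //=; congr (_ * _).
by rewrite insubT.
Qed.

Lemma elem_mesym k : elem shifted_var N k = mesym N K k.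
Proof.
rewrite elem_bounded // /mesym; apply: eq_bigl => h.
by rewrite (_ : [set i | _] = setT) ?subsetT ?andbT //; apply/setP => i; rewrite !inE ltn_ord.
Qed.
End Elem.

(** * LLT polynomials of subtuples as coloured sums *)

Lemma enum_val_mono (l : nat) (A : {set 'I_l}) (i j : 'I_#|A|) :
  (enum_val i < enum_val j)%N = (i < j)%N.
Proof.
have homo (a b : 'I_#|A|) : (a < b)%N -> (enum_val a < enum_val b)%N.
  move=> ltab; have x0 := enum_val a.
  have srt : sorted (fun u v : 'I_l => (u < v)%N) (enum A).
    rewrite /enum_mem; apply: sorted_filter; first by move=> ? ? ?; apply: ltn_trans.
    by rewrite -enumT -(sorted_map (f := val) (e' := ltn)) val_enum_ord iota_ltn_sorted.
  rewrite !(enum_val_nth x0); apply: (sorted_ltn_nth _ _ srt) => //.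
  - by move=> ? ? ?; apply: ltn_trans.
  - by rewrite inE -cardE.
  - by rewrite inE -cardE.
case: (ltngtP i j) => [/homo //|/homo/ltnW|/val_inj->]; last by rewrite ltnn.
by rewrite leqNgt => /negPf.
Qed.

Section Transport.
Variables (l r : nat) (nu : 'I_l -> vstrip) (f : 'I_l -> 'I_r) (B : {set 'I_r}).
Variables (N : nat) (K : fieldType).
Local Notation nuB := (@restrict l r nu f B).

Definition embed (b : box nuB) : box nu :=
  Tagged (fun i => 'I_(strip_len (nu i))) (tagged b : 'I_(strip_len (nu (enum_val (tag b))))).

Definition boxes_in : {set box nu} := [set b | f (tag b) \in B].

Lemma embed_inj : injective embed.
Proof.
move=> [i j] [i' j'] e; have ei : i = i' by have /enum_val_inj := congr1 (@tag _ _) e.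
subst i'; congr (Tagged _ _); apply: val_inj.
by have := congr1 (fun b : box nu => nat_of_ord (tagged b)) e.
Qed.

Lemma content_embed b : content (embed b) = content b.
Proof. by []. Qed.

Lemma attacks_embed b c : attacks (embed b) (embed c) = attacks b c.
Proof. by rewrite !attacksE !content_embed !enum_val_mono. Qed.

Lemma typeI_embed b c : typeI_edge (embed b) (embed c) = typeI_edge b c.
Proof. by rewrite /typeI_edge (inj_eq enum_val_inj). Qed.

Lemma embed_in v : reflect (exists b, v = embed b) (v \in boxes_in).
Proof.
rewrite inE; apply: (iffP idP) => [fv|[b ->] /=]; last first.
  by have := enum_valP (tag b); rewrite inE.
case: v fv => i j /= fi; have iA : i \in f @^-1: B by rewrite inE.
have [k ek] : exists k : 'I_#|f @^-1: B|, enum_val k = i.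
  by exists (enum_rank_in iA i); rewrite enum_rankK_in.
by subst i; exists (Tagged (fun i => 'I_(strip_len (nuB i))) (j : 'I_(strip_len (nuB k)))).
Qed.

(** It is enough to compare vertically adjacent boxes. *)
Lemma semistandardE (T : filling N nuB) :
  semistandard T = [forall b, forall c, typeI_edge b c ==> (T c < T b)%N].
Proof.
apply/idP/idP => [/forallP st|/forallP st].
  apply/forallP => b; apply/forallP => c; apply/implyP => /andP[et /eqP er].
  have := forallP (st c) b; rewrite (eq_sym (tag c)) et implyTb er => /andP[_].
  by rewrite ltnSn.
have step i (j j' : 'I_(strip_len (nuB i))) : (j < j')%N ->
    (T (Tagged (fun i => 'I_(strip_len (nuB i))) j)
     < T (Tagged (fun i => 'I_(strip_len (nuB i))) j'))%N.
  case: j' => j' ltj'; elim: j' ltj' => // k IHk ltk; rewrite /= ltnS leq_eqVlt => jk.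
  have ltk' := ltnW ltk.
  have : (T (Tagged (fun i => 'I_(strip_len (nuB i))) (Ordinal ltk'))
     < T (Tagged (fun i => 'I_(strip_len (nuB i))) (Ordinal ltk)))%N.
    have := forallP (st (Tagged _ (Ordinal ltk))) (Tagged _ (Ordinal ltk')).
    by move/implyP; apply; rewrite /typeI_edge /box_row /= !addnS !eqxx.
  case/orP: jk => [/eqP ejk|jk]; last by apply: ltn_trans; apply: IHk.
  by rewrite (_ : j = Ordinal ltk') //; apply: val_inj.
apply/forallP => -[i j]; apply/forallP => -[i' j']; apply/implyP => /= /eqP ei; subst i'.
rewrite /box_col /= ?andbF ?eqxx /= /box_row /= ltn_add2l ltnS; apply/implyP; exact: step.
Qed.

Definition extend (T : filling N nuB) : {ffun box nu -> 'I_N.+1} :=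
  [ffun v => if [pick b | embed b == v] is Some b then lift ord0 (T b) else ord0].

Lemma extend_embed T b : extend T (embed b) = lift ord0 (T b).
Proof.
rewrite ffunE; case: pickP => [c /eqP/embed_inj -> //|none].
by have := none b; rewrite eqxx.
Qed.

Lemma extend_out T v : v \notin boxes_in -> extend T v = ord0.
Proof.
move=> vB; rewrite ffunE; case: pickP => [c /eqP ev|//].
by case/negP: vB; apply/embed_in; exists c.
Qed.

Lemma extend_inj : injective extend.
Proof.
move=> T T' e; apply/ffunP => b; apply: (@lift_inj _ ord0).
by rewrite -!extend_embed e.
Qed.

Lemma extend_onto k : supp_on boxes_in k -> exists T, k = extend T.
Proof.
move=> /forallP sup.
have /fin_all_exists[T TE] : forall b, exists j : 'I_N, k (embed b) = lift ord0 j.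
  move=> b; have : k (embed b) != ord0.
    by rewrite (eqP (sup _)); apply/embed_in; exists b.
  by rewrite eq_sym => /unlift_some[j ej _]; exists j.
exists (finfun T); apply/ffunP => v; case: (boolP (v \in boxes_in)) => [/embed_in[b ->]|vB].
  by rewrite extend_embed ffunE.
rewrite extend_out //; apply/eqP; rewrite -[_ == _]negbK (eqP (sup v)); exact: vB.
Qed.

Lemma supp_extend T : supp_on boxes_in (extend T).
Proof.
apply/forallP => v; case: (boolP (v \in boxes_in)) => [/embed_in[b ->]|vB].
  by rewrite extend_embed eqb_id eq_sym neq_lift.
by rewrite extend_out // eqxx.
Qed.

Local Notation square := (setX boxes_in boxes_in).

Lemma LLT_strict_color_sum (t : K) :
  LLT N t nuB = strict_color_sum (shifted_var N K) N t%:MP (column_edges nu :&: square)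
                  (double_edges nu :&: square) boxes_in.
Proof.
rewrite /LLT /strict_color_sum.
have eA : [set k : {ffun box nu -> 'I_N.+1} | supp_on boxes_in k &&
    (descents (column_edges nu :&: square) k == column_edges nu :&: square)]
  = extend @: [set T : filling N nuB | semistandard T].
  have key T : (descents (column_edges nu :&: square) (extend T) == column_edges nu :&: square)
      = semistandard T.
    rewrite semistandardE; apply/eqP/forallP => [/setP ed b|st].
      apply/forallP => c; apply/implyP => bc; have := ed (embed b, embed c).
      rewrite !inE /= typeI_embed bc /= !extend_embed.
      have bin d : embed d \in boxes_in by apply/embed_in; exists d.
      by have := bin b; have := bin c; rewrite !inE => -> -> /=.
    apply/setP => -[u v]; rewrite inE; case: (boolP (_ \in _)) => //=.
    rewrite !in_setI => /andP[uv]; rewrite in_setX /= => /andP[/embed_in[b eb] /embed_in[c ec]].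
    move: uv; rewrite inE /= eb ec typeI_embed !extend_embed => bc.
    by have /forallP/(_ c) := st b; rewrite bc.
  apply/setP => k; rewrite inE; apply/andP/imsetP => [[/extend_onto[T ->]]|[T]].
    by rewrite key => sT; exists T; rewrite ?inE.
  by rewrite inE => sT ->; rewrite key supp_extend.
transitivity (\sum_(k in [set k : {ffun box nu -> 'I_N.+1} | supp_on boxes_in k &&
    (descents (column_edges nu :&: square) k == column_edges nu :&: square)])
    t%:MP ^+ #|descents (double_edges nu :&: square) k| * \prod_(v in boxes_in) shifted_var N K (k v));
  last by apply: eq_bigl => k; rewrite inE.
rewrite eA big_imset /=; last by move=> ? ? _ _; apply: extend_inj.
apply: eq_big => [T|T _]; first by rewrite inE.
rewrite -rmorphXn mul_mpolyC; congr (_ ^+ _ *: _).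
  rewrite /Defs.inv -(card_imset _ (f := fun p : box nuB * box nuB => (embed p.1, embed p.2))); last first.
    move=> [b c] [b' c'] /= e.
    by rewrite (embed_inj (congr1 fst e)) (embed_inj (congr1 snd e)).
  apply: eq_card => -[u v]; apply/imsetP/idP => [[[b c]]|].
    rewrite inE /= => /andP[att lt] [-> ->].
    have bin d : embed d \in boxes_in by apply/embed_in; exists d.
    by rewrite inE /= !extend_embed in_setI in_setX /= !bin inE /= attacks_embed att.
  rewrite inE in_setI in_setX /= => /andP[/andP[att /andP[/embed_in[b eb] /embed_in[c ec]]]].
  move: att; rewrite inE /= eb ec attacks_embed !extend_embed => att lt.
  by exists (b, c); rewrite ?inE /= ?att.
have -> : boxes_in = embed @: [set: box nuB].
  apply/setP => v; apply/embed_in/imsetP => [[b ->]|[b _ ->]]; by exists b.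
rewrite big_imset /=; last by move=> ? ? _ _; apply: embed_inj.
by apply: eq_big => [b|b _]; rewrite ?inE // extend_embed shifted_var_lift.
Qed.
End Transport.

(** * Cumulants *)

Section Cumulant.
Variables (l r : nat) (nu : 'I_l -> vstrip) (f : 'I_l -> 'I_r) (N : nat).
Variables (K : fieldType) (q : K).
Hypothesis q_neq0 : q != 0.
Local Notation lab := (@shifted_content l nu).
Local Notation class_sumN := (strict_class_sum lab (q%:MP_[N]) (shifted_var N K) N).
Implicit Types (E : {set box nu * box nu}) (B : {set 'I_r}) (P : {set {set 'I_r}}).

Lemma LLT_class_sum B :
  LLT N (q + 1) (@restrict l r nu f B)
  = class_sumN (column_edges nu :&: setX (boxes_in nu f B) (boxes_in nu f B))
      (double_edges nu :&: setX (boxes_in nu f B) (boxes_in nu f B)) (boxes_in nu f B).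
Proof.
rewrite LLT_strict_color_sum addrC mpolyCD mpolyC1; apply: strict_color_class_sum.
- exact: label_inj.
- by rewrite mpolyC_eq0.
- apply: disjointWl (subsetIl _ _) _; apply: disjointWr (subsetIl _ _) _.
  exact: columns_double_disjoint.
move=> S sS; exists (double_edges nu :|: S).
  by apply: dyck_edges; apply: subset_trans sS (subsetIl _ _).
rewrite setIUl; congr (_ :|: _); symmetry; apply/setIidPl.
by apply: subset_trans sS (subsetIr _ _).
Qed.

Definition monochromatic P E :=
  [forall p in E, pblock P (f (tag p.1)) == pblock P (f (tag p.2))].

Lemma prod_LLT P : partition P [set: 'I_r] ->
  \prod_(B in P) LLT N (q + 1) (@restrict l r nu f B)
  = \sum_(E : {set box nu * box nu} | (E \subset double_edges nu) && monochromatic P E)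
      q ^+ #|E| *: mesym_part N K (lambda E).
Proof.
move=> partP; pose c (b : box nu) := pblock P (f (tag b)).
have coverP i : i \in cover P by rewrite (cover_partition partP).
have tI := partition_trivIset partP.
have inB B : B \in P -> boxes_in nu f B = c @^-1: [set B].
  move=> BP; apply/setP => b; rewrite !inE; apply/idP/eqP => [bB|<-].
    exact: def_pblock tI BP bB.
  by rewrite mem_pblock.
rewrite (eq_bigr (fun B => class_sumN
   (column_edges nu :&: setX (c @^-1: [set B]) (c @^-1: [set B]))
   (double_edges nu :&: setX (c @^-1: [set B]) (c @^-1: [set B])) (c @^-1: [set B]))); last first.
  by move=> B BP; rewrite LLT_class_sum inB.
rewrite strict_class_sum_blocks; first last.
- by move=> [u v]; rewrite inE => /andP[/eqP euv _]; rewrite /c /= euv.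
- exact: label_inj.
have -> : c @^-1: P = [set: box nu].
  by apply/setP => b; rewrite !inE; apply: pblock_mem.
have -> : setX [set: box nu] [set: box nu] = setT by apply/setP => p; rewrite !inE.
rewrite !setIT /strict_class_sum; apply: eq_big => E.
  apply/subsetP/andP => [sE|[/subsetP sE /forall_inP mE] p pE]; last first.
    by have := sE _ pE; rewrite !inE => ->; exact: mE.
  split; first by apply/subsetP => p /sE; rewrite !inE => /andP[].
  by apply/forall_inP => p /sE; rewrite inE => /andP[].
move=> sE; rewrite -rmorphXn mul_mpolyC mesym_part_lambda; last first.
  by apply: subset_trans sE _; apply/subsetP => p; rewrite !inE => /andP[].
by congr (_ *: _); apply: eq_bigr => u _; rewrite elem_mesym.
Qed.

(** Type I edges join boxes of the same colour, so they never obstruct. *)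
Lemma monochromatic_stable P E : partition P [set: 'I_r] ->
  monochromatic P E = [forall B in P, stable (contracted_edge E f) B].
Proof.
move=> partP; have tI := partition_trivIset partP.
have coverP i : i \in cover P by rewrite (cover_partition partP).
apply/forall_inP/forall_inP => [mE B BP|st [b c] bc].
  apply/stableP => i j /existsP[b /existsP[c /and3P[/eqP <- /eqP <-]]].
  have eqB u v : edge E u v -> (f (tag u) \in B) = (f (tag v) \in B).
    have same : pblock P (f (tag u)) = pblock P (f (tag v)) -> (f (tag u) \in B) = (f (tag v) \in B).
      move=> e; apply/idP/idP => iB.
        by rewrite -(def_pblock tI BP iB) e mem_pblock.
      by rewrite -(def_pblock tI BP iB) -e mem_pblock.
    case/orP => [/andP[/eqP -> //]|uv]; apply: same.
    exact/eqP/(mE (u, v)).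
  by case/orP => [/eqB|/eqB ->].
have BP := pblock_mem (coverP (f (tag b))).
have /stableP/(_ (f (tag b)) (f (tag c))) := st _ BP.
rewrite mem_pblock coverP => H; apply/eqP.
have cB : f (tag c) \in pblock P (f (tag b)).
  rewrite -H //; apply/existsP; exists b; apply/existsP; exists c.
  by rewrite !eqxx /edge bc orbT.
by rewrite (def_pblock tI BP cB).
Qed.

Lemma contracted_sym E : ssrbool.symmetric (contracted_edge E f).
Proof.
have half i j : contracted_edge E f i j -> contracted_edge E f j i.
  case/existsP => b /existsP[c /and3P[fi fj bc]].
  by apply/existsP; exists c; apply/existsP; exists b; rewrite fi fj orbC.
by move=> i j; apply/idP/idP; apply: half.
Qed.

Lemma cumulant_expansion : (0 < r)%N ->
  LLT_cumulant N (q + 1) nu f =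
  \sum_(E : {set box nu * box nu} | (E \subset double_edges nu) && f_connected E f)
     q ^ (#|E|%:Z + 1 - r%:Z) *: mesym_part N K (lambda E).
Proof.
move=> r_gt0; rewrite /LLT_cumulant addrK.
under eq_bigr => P partP do rewrite prod_LLT //.
rewrite scaler_sumr.
under eq_bigr => P partP do rewrite big_mkcondr !scaler_sumr.
rewrite exchange_big /= [RHS]big_mkcondr /=; apply: eq_bigr => E sE.
transitivity ((q ^ (1 - r%:Z) * q ^+ #|E| *
   \sum_(P : {set {set 'I_r}} | stable_partition (contracted_edge E f) P) cumulant_coef K #|P|)
   *: mesym_part N K (lambda E)).
  rewrite /stable_partition [X in _ * X]big_mkcondr big_distrr scaler_suml /=; apply: eq_bigr => P partP.
  rewrite -(monochromatic_stable E partP); case: ifP => _; last by rewrite mulr0 !scaler0 scale0r.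
  by rewrite !scalerA; congr (_ *: _); rewrite mulrA mulrAC mulrA.
rewrite (stable_partition_sum (Ordinal r_gt0) K (contracted_sym E)) -/(f_connected E f).
case: (f_connected E f); last by rewrite mulr0 scale0r.
rewrite mulr1 -[q ^+ _]/(q ^ #|E|%:Z) -expfzDr //; congr (q ^ _ *: _).
by rewrite -[RHS]addrA addrC.
Qed.
End Cumulant.

Theorem theorem3p17 (l r : nat) (hr : (0 < r)%N)
    (nu : 'I_l -> vstrip) (f : 'I_l -> 'I_r)
    (fsurj : forall c : 'I_r, exists i : 'I_l, f i = c) (N : nat) :
  LLT_cumulant N (qvar + 1) nu f =
  \sum_(E : {set box nu * box nu} | (E \subset double_edges nu) && f_connected E f)
     qvar ^ (#|E|%:Z + 1 - r%:Z) *: mesym_part N Qq (lambda E).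
Proof.
apply: cumulant_expansion => //.
by rewrite tofrac_eq0 polyX_eq0.
Qed.
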